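(* Let $(\mathcal T,[1],\Delta)$ be a triangulated category and $\xi$ a proper class of triangles. Let $\Omega$ denote the class of hereditary complete cotorsion pairs $(\mathcal X,\mathcal Y)$ in $\mathcal T$ with respect to $\xi$ such that $\omega=\mathcal X\cap\mathcal Y$ is contravariantly finite in $\mathcal T$, and $\Gamma$ the class of weakly $\xi$-projective model structures on $\mathcal T$. Then the map $$\Phi:(\mathcal X,\mathcal Y)\mapsto(\mathrm{CoFib}_\omega^\xi,\mathrm{Fib}_\omega^\xi,\mathrm{Weq}_\omega^\xi)$$ where $$\mathrm{CoFib}_\omega^\xi=\{\xi\text{-proper monomorphisms } f\mid \mathrm{hoCoker} f\in\mathcal X\},$$ $$\mathrm{Fib}_\omega^\xi=\{\text{morphisms } f\mid \mathrm{Hom}_{\mathcal T}(W,f)\text{ is surjective for all }W\in\omega\},$$ $$\mathrm{Weq}_\omega^\xi=\{f:A\to B\mid \text{there is a }\xi\text{-proper epimorphism }(f,t):A\oplus W\to B\text{ with }W\in\omega\text{ and }\mathrm{hoKer}(f,t)\in\mathcal Y\},$$ gives a bijection between $\Omega$ and $\Gamma$, with inverse given by $\Psi:(\mathrm{CoFib},\mathrm{Fib},\mathrm{Weq})\mapsto(\mathcal C,\mathrm T\mathcal F)$, where $\mathcal C$ and $\mathrm T\mathcal F$ are respectively the class of cofibrant objects and the class of trivially fibrant objects of the model structure $(\mathrm{CoFib},\mathrm{Fib},\mathrm{Weq})$.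
   Context: $(\mathcal T,[1],\Delta)$ denotes a triangulated category with suspension autoequivalence $[1]$ (quasi-inverse $[-1]$) and class $\Delta$ of (distinguished) triangles. A triangle $X\xrightarrow{u}Y\xrightarrow{v}Z\xrightarrow{w}X[1]$ is splitting if $w=0$. A class $\xi\subseteq\Delta$ is a proper class of triangles if: (i) it contains all splitting triangles; (ii) it is closed under isomorphisms of triangles, finite coproducts and suspensions (if $X\xrightarrow{u}Y\xrightarrow{v}Z\xrightarrow{w}X[1]$ is in $\xi$ then so is $X[i]\xrightarrow{(-1)^iu[i]}Y[i]\xrightarrow{(-1)^iv[i]}Z[i]\xrightarrow{(-1)^iw[i]}X[i+1]$ for all $i\in\mathbb Z$); (iii) it is closed under base changes (if $X\to Y\to Z\xrightarrow{w}X[1]$ is in $\xi$ and $\alpha:Z'\to Z$ is any morphism, then the triangle $X\to Y'\to Z'\xrightarrow{w\alpha}X[1]$ is in $\xi$) and cobase changes (if moreover $\beta:X\to X'$ is any morphism, then the triangle $X'\to Y'\to Z\xrightarrow{\beta[1]w}X'[1]$ is in $\xi$); (iv) it is saturated: for any triangle $X\to Y\to Z\xrightarrow{w}X[1]$ and any morphism $\alpha:Z'\to Z$ embedded in a triangle $X'\to Z'\xrightarrow{\alpha}Z\to X'[1]$ in $\xi$, if the base change $X\to Y'\to Z'\xrightarrow{w\alpha}X[1]$ is in $\xi$, then $X\to Y\to Z\xrightarrow{w}X[1]$ is in $\xi$. A morphism $u:X\to Y$ is a $\xi$-proper monomorphism if there is a triangle $X\xrightarrow{u}Y\to Z\to X[1]$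 in $\xi$, and a $\xi$-proper epimorphism if there is a triangle $Z[-1]\to X\xrightarrow{u}Y\to Z$ in $\xi$. For $u:X\to Y$, the hocokernel $\mathrm{hoCoker}\,u$ is the object $Z$ in a triangle $X\xrightarrow{u}Y\to Z\to X[1]$, and the hokernel $\mathrm{hoKer}\,u$ is the object $W$ in a triangle $W\to X\xrightarrow{u}Y\to W[1]$ (unique up to isomorphism). $\mathrm{Ext}_\xi(X,Y)$ is the abelian group (under Baer sum) of equivalence classes of triangles $Y\to E\to X\to Y[1]$ in $\xi$, two such triangles being equivalent if there is a morphism of triangles between them which is the identity on $Y$ and on $X$; the zero element is the class of the splitting triangle. A pair $(\mathcal X,\mathcal Y)$ of classes of objects is a cotorsion pair with respect to $\xi$ if $\mathcal Y=\{Z\mid \mathrm{Ext}_\xi(X,Z)=0\ \forall X\in\mathcal X\}$ and $\mathcal X=\{Z\mid \mathrm{Ext}_\xi(Z,Y)=0\ \forall Y\in\mathcal Y\}$. It is complete if for each $T\in\mathcal T$ there are triangles $Y\to X\to T\to Y[1]$ and $T\to Y'\to X'\to T[1]$ in $\xi$ with $X,X'\in\mathcal X$, $Y,Y'\in\mathcal Y$. It is hereditary if: for every triangle $K\to X_1\to X_2\to K[1]$ in $\xi$ with $X_1,X_2\in\mathcal X$ one has $K\in\mathcal X$; and for every triangle $Y_1\to Y_2\to C\to Y_1[1]$ in $\xi$ with $Y_1,Y_2\in\mathcal Y$ one has $C\in\mathcal Y$. $\omega$ is contravariantly finite in $\mathcal T$ if each $T\in\mathcal T$ has a right $\omega$-approximation,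 i.e. a morphism $W\to T$ with $W\in\omega$ through which every morphism $W'\to T$ with $W'\in\omega$ factors. A model structure on a category is a triple $(\mathrm{CoFib},\mathrm{Fib},\mathrm{Weq})$ of classes of morphisms (cofibrations, fibrations, weak equivalences) satisfying: $\mathrm{Weq}$ has the two-out-of-three property; each class is closed under retracts; every commutative square with left side $i\in\mathrm{CoFib}$ and right side $p\in\mathrm{Fib}$ has a lifting if $i\in\mathrm{Weq}$ or $p\in\mathrm{Weq}$; every morphism factors as $pi=qj$ with $i\in\mathrm{CoFib}\cap\mathrm{Weq}$, $p\in\mathrm{Fib}$, $j\in\mathrm{CoFib}$, $q\in\mathrm{Fib}\cap\mathrm{Weq}$. (No existence of limits or colimits is assumed.) Trivial fibrations are the morphisms in $\mathrm{Fib}\cap\mathrm{Weq}$. An object $X$ is cofibrant if $0\to X$ is a cofibration, fibrant if $X\to0$ is a fibration, trivial if $0\to X$ (equivalently $X\to 0$) is a weak equivalence, trivially fibrant if it is trivial and fibrant. A model structure on $\mathcal T$ is weakly $\xi$-projective if the cofibrations are precisely the $\xi$-proper monomorphisms with cofibrant hocokernel, the trivial fibrations are precisely the $\xi$-proper epimorphisms with trivially fibrant hokernel, and each object is fibrant. *)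

(* Defs.v *)
From mathcomp Require Import all_boot all_algebra.
From mathcomp Require Import boolp classical_sets functions.

Set Implicit Arguments.
Unset Strict Implicit.
Unset Printing Implicit Defensive.

Import GRing.Theory.

Local Open Scope classical_set_scope.
Local Open Scope ring_scope.

Reserved Notation "g \oc f" (at level 40, left associativity).

(** * Additive categories *)

Record additiveCategory := AdditiveCategory {
  Ob :> Type;
  hom : Ob -> Ob -> zmodType;
  idm : forall X, hom X X;
  comp : forall X Y Z, hom Y Z -> hom X Y -> hom X Z;
  compA : forall X Y Z W (h : hom Z W) (g : hom Y Z) (f : hom X Y),
    comp h (comp g f) = comp (comp h g) f;
  comp1m : forall X Y (f : hom X Y), comp (idm Y) f = f;
  compm1 : forall X Y (f : hom X Y), comp f (idm X) = f;
  compDl : forall X Y Z (g g' : hom Y Z) (f : hom X Y),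
    comp (g + g') f = comp g f + comp g' f;
  compDr : forall X Y Z (g : hom Y Z) (f f' : hom X Y),
    comp g (f + f') = comp g f + comp g f';
  zob : Ob;
  zob_initial : forall X (f : hom zob X), f = 0;
  zob_terminal : forall X (f : hom X zob), f = 0;
  bip : Ob -> Ob -> Ob;
  in1 : forall A B, hom A (bip A B);
  in2 : forall A B, hom B (bip A B);
  pr1 : forall A B, hom (bip A B) A;
  pr2 : forall A B, hom (bip A B) B;
  pr1_in1 : forall A B, comp (pr1 A B) (in1 A B) = idm A;
  pr2_in2 : forall A B, comp (pr2 A B) (in2 A B) = idm B;
  pr1_in2 : forall A B, comp (pr1 A B) (in2 A B) = 0;
  pr2_in1 : forall A B, comp (pr2 A B) (in1 A B) = 0;
  bip_id : forall A B,
    comp (in1 A B) (pr1 A B) + comp (in2 A B) (pr2 A B) = idm (bip A B)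
}.

Arguments hom {a} X Y.
Arguments idm {a} X.
Arguments comp {a} [X Y Z] g f.
Arguments zob {a}.
Arguments bip {a} A B.
Arguments in1 {a A B}.
Arguments in2 {a A B}.
Arguments pr1 {a A B}.
Arguments pr2 {a A B}.

Notation "g \oc f" := (comp g f) : ring_scope.

Section AdditiveCategoryDefs.
Variable C : additiveCategory.

Definition is_iso (X Y : C) (f : hom X Y) : Prop :=
  exists2 g : hom Y X, g \oc f = idm X & f \oc g = idm Y.

(* the morphism (f, t) : A (+) W -> B *)
Definition copair (A W B : C) (f : hom A B) (t : hom W B) : hom (bip A W) B :=
  f \oc pr1 + t \oc pr2.

(* f (+) g *)
Definition bipm (A B A' B' : C) (f : hom A B) (g : hom A' B') :
    hom (bip A A') (bip B B') :=
  in1 \oc f \oc pr1 + in2 \oc g \oc pr2.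

End AdditiveCategoryDefs.

Record endofunctor (C : additiveCategory) := Endofunctor {
  fob :> C -> C;
  fmap : forall X Y, hom X Y -> hom (fob X) (fob Y);
  fmap1 : forall X, fmap (idm X) = idm (fob X);
  fmapM : forall X Y Z (g : hom Y Z) (f : hom X Y),
    fmap (g \oc f) = fmap g \oc fmap f;
  fmapD : forall X Y (f g : hom X Y), fmap (f + g) = fmap f + fmap g
}.
Arguments fmap {C} e [X Y] f.

(* An additive autoequivalence [shift] = [1] with quasi-inverse [unshift] =   *)
(* [-1]. The unit and counit isomorphisms can always be chosen to satisfy the *)
(* triangle identity [shift_adj] (which implies the other one); it makes      *)
(* X[1][-1] = X = X[-1][1] a coherent identification.                         *)
Record autoequivalence (C : additiveCategory) := Autoequivalence {
  shift : endofunctor C;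
  unshift : endofunctor C;
  counit : forall X, hom (shift (unshift X)) X;
  counitV : forall X, hom X (shift (unshift X));
  counitK : forall X, counitV X \oc counit X = idm _;
  counitVK : forall X, counit X \oc counitV X = idm _;
  counit_nat : forall X Y (f : hom X Y),
    counit Y \oc fmap shift (fmap unshift f) = f \oc counit X;
  unit_ : forall X, hom X (unshift (shift X));
  unitV : forall X, hom (unshift (shift X)) X;
  unitK : forall X, unitV X \oc unit_ X = idm _;
  unitVK : forall X, unit_ X \oc unitV X = idm _;
  unit_nat : forall X Y (f : hom X Y),
    fmap unshift (fmap shift f) \oc unit_ X = unit_ Y \oc f;
  shift_adj : forall X, counit (shift X) \oc fmap shift (unit_ X) = idm _
}.

(** * Candidate triangles and triangulated categories *)

Record triangle (C : additiveCategory) (S : C -> C) := Tri {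
  tX : C; tY : C; tZ : C;
  tu : hom tX tY;
  tv : hom tY tZ;
  tw : hom tZ (S tX)
}.
Arguments Tri {C S tX tY tZ} tu tv tw.

Section TriangleMorphisms.
Variables (C : additiveCategory) (S : endofunctor C).

Definition triangle_morphism (t t' : triangle S) (a : hom (tX t) (tX t'))
    (b : hom (tY t) (tY t')) (c : hom (tZ t) (tZ t')) : Prop :=
  [/\ b \oc tu t = tu t' \oc a,
      c \oc tv t = tv t' \oc b
    & fmap S a \oc tw t = tw t' \oc c].

Definition triangle_iso (t t' : triangle S) : Prop :=
  exists (a : hom (tX t) (tX t')) (b : hom (tY t) (tY t'))
         (c : hom (tZ t) (tZ t')),
    [/\ triangle_morphism a b c, is_iso a, is_iso b & is_iso c].

End TriangleMorphisms.

Record triangulatedCategory := TriangulatedCategory {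
  tcat :> additiveCategory;
  susp : autoequivalence tcat;
  distinguished : set (triangle (shift susp));
  TR1_iso : forall t t', triangle_iso t t' ->
    distinguished t -> distinguished t';
  TR1_id : forall X : tcat,
    distinguished (Tri (idm X) (0 : hom X zob) (0 : hom zob (shift susp X)));
  TR1_cone : forall (X Y : tcat) (u : hom X Y),
    exists (Z : tcat) (v : hom Y Z) (w : hom Z (shift susp X)),
      distinguished (Tri u v w);
  TR2 : forall (X Y Z : tcat) (u : hom X Y) (v : hom Y Z)
      (w : hom Z (shift susp X)),
    distinguished (Tri u v w) <->
    distinguished (Tri v w (- fmap (shift susp) u));
  TR3 : forall (t t' : triangle (shift susp)) (a : hom (tX t) (tX t'))
      (b : hom (tY t) (tY t')),
    distinguished t -> distinguished t' -> b \oc tu t = tu t' \oc a ->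
    exists c : hom (tZ t) (tZ t'), triangle_morphism a b c;
  TR4 : forall (X Y Z X' Y' Z' : tcat) (u : hom X Y) (v : hom Y Z)
      (i : hom Y Z') (i' : hom Z' (shift susp X))
      (j : hom Z X') (j' : hom X' (shift susp Y))
      (k : hom Z Y') (k' : hom Y' (shift susp X)),
    distinguished (Tri u i i') ->
    distinguished (Tri v j j') ->
    distinguished (Tri (v \oc u) k k') ->
    exists (f : hom Z' Y') (g : hom Y' X'),
      [/\ distinguished (Tri f g (fmap (shift susp) i \oc j')),
          f \oc i = k \oc v, k' \oc f = i', g \oc k = j
        & j' \oc g = fmap (shift susp) u \oc k']
}.

Notation Sh T := (shift (susp T)).
Notation Un T := (unshift (susp T)).
Notation tri T := (triangle (Sh T)).

Section Triangulated.
Variable T : triangulatedCategory.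
Implicit Types (xi : set (tri T)) (t : tri T).

(** * Proper classes of triangles *)

Definition splitting t : Prop := distinguished t /\ tw t = 0.

(* The third morphism is w (+) w' followed by the canonical isomorphism       *)
(* Z[1] (+) Z'[1] = (Z (+) Z')[1].                                            *)
Definition tri_sum t t' : tri T :=
  Tri (bipm (tu t) (tu t')) (bipm (tv t) (tv t'))
      (copair (fmap (Sh T) in1 \oc tw t) (fmap (Sh T) in2 \oc tw t')).

Definition tri_shift t : tri T :=
  Tri (- fmap (Sh T) (tu t)) (- fmap (Sh T) (tv t)) (- fmap (Sh T) (tw t)).

(* Here w[-1] : Z[-1] -> X[1][-1] = X = X[-1][1]. *)
Definition tri_unshift t : tri T :=
  Tri (- fmap (Un T) (tu t)) (- fmap (Un T) (tv t))
      (- (counitV (susp T) (tX t) \oc unitV (susp T) (tX t)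
            \oc fmap (Un T) (tw t))).

Definition tri_shiftz (i : int) t : tri T :=
  match i with
  | Posz n => iter n tri_shift t
  | Negz n => iter n.+1 tri_unshift t
  end.

(* The empty coproduct is the zero triangle, which is splitting. *)
Definition closed_coproducts xi : Prop :=
  forall t t', xi t -> xi t' -> xi (tri_sum t t').

Definition closed_base_change xi : Prop :=
  forall (X Y Z : T) (u : hom X Y) (v : hom Y Z) (w : hom Z (Sh T X))
    (Z' : T) (alpha : hom Z' Z) (Y' : T) (u' : hom X Y') (v' : hom Y' Z'),
  xi (Tri u v w) -> distinguished (Tri u' v' (w \oc alpha)) ->
  xi (Tri u' v' (w \oc alpha)).

Definition closed_cobase_change xi : Prop :=
  forall (X Y Z : T) (u : hom X Y) (v : hom Y Z) (w : hom Z (Sh T X))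
    (X' : T) (beta : hom X X') (Y' : T) (u' : hom X' Y') (v' : hom Y' Z),
  xi (Tri u v w) -> distinguished (Tri u' v' (fmap (Sh T) beta \oc w)) ->
  xi (Tri u' v' (fmap (Sh T) beta \oc w)).

Definition saturated xi : Prop :=
  forall (X Y Z : T) (u : hom X Y) (v : hom Y Z) (w : hom Z (Sh T X))
    (X' Z' : T) (x : hom X' Z') (alpha : hom Z' Z) (y : hom Z (Sh T X'))
    (Y' : T) (u' : hom X Y') (v' : hom Y' Z'),
  distinguished (Tri u v w) -> xi (Tri x alpha y) ->
  xi (Tri u' v' (w \oc alpha)) -> xi (Tri u v w).

Record proper_class xi : Prop := ProperClass {
  pc_distinguished : xi `<=` @distinguished T;
  pc_splitting : splitting `<=` xi;
  pc_iso : forall t t', triangle_iso t t' -> xi t -> xi t';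
  pc_coproducts : closed_coproducts xi;
  pc_suspensions : forall (i : int) t, xi t -> xi (tri_shiftz i t);
  pc_base_change : closed_base_change xi;
  pc_cobase_change : closed_cobase_change xi;
  pc_saturated : saturated xi
}.

Definition proper_mono xi (X Y : T) (u : hom X Y) : Prop :=
  exists (Z : T) (v : hom Y Z) (w : hom Z (Sh T X)), xi (Tri u v w).

(* A triangle Z[-1] -> X -> Y -> Z, where Z is identified with Z[-1][1]. *)
Definition proper_epi xi (X Y : T) (u : hom X Y) : Prop :=
  exists (Z : T) (a : hom (Un T Z) X) (b : hom Y Z),
    xi (Tri a u (counitV (susp T) Z \oc b)).

Definition is_hocoker (X Y : T) (u : hom X Y) (Z : T) : Prop :=
  exists (v : hom Y Z) (w : hom Z (Sh T X)), distinguished (Tri u v w).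

Definition is_hoker (X Y : T) (u : hom X Y) (W : T) : Prop :=
  exists (a : hom W X) (b : hom Y (Sh T W)), distinguished (Tri a u b).

(* Homotopy (co)kernels are unique up to isomorphism, and these predicates    *)
(* are only used with classes A that are closed under isomorphism.            *)
Definition hocoker_in (A : set T) (X Y : T) (u : hom X Y) : Prop :=
  exists2 Z, is_hocoker u Z & A Z.

Definition hoker_in (A : set T) (X Y : T) (u : hom X Y) : Prop :=
  exists2 W, is_hoker u W & A W.

(** * Extensions and cotorsion pairs *)

Record extension (X Y : T) := Extension {
  emid : T;
  ein : hom Y emid;
  epr : hom emid X;
  ecl : hom X (Sh T Y)
}.

Definition ext_tri (X Y : T) (e : extension X Y) : tri T :=
  Tri (ein e) (epr e) (ecl e).

Definition ext_equiv (X Y : T) (e e' : extension X Y) : Prop :=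
  exists g : hom (emid e) (emid e'),
    @triangle_morphism T (Sh T) (ext_tri e) (ext_tri e') (idm Y) g (idm X).

Definition ext_class xi (X Y : T) (e : extension X Y) : set (extension X Y) :=
  [set e' | xi (ext_tri e') /\ ext_equiv e e'].

(* The underlying set of the group Ext_xi(X, Y); only its vanishing is needed *)
(* below, so the Baer sum is not defined.                                     *)
Definition Ext xi (X Y : T) : set (set (extension X Y)) :=
  [set ext_class xi e | e in [set e | xi (ext_tri e)]].
Arguments Ext xi X Y : clear implicits.

Definition ext0 (X Y : T) : extension X Y :=
  @Extension X Y (bip Y X) in1 pr2 0.

Definition Ext_eq0 xi (X Y : T) : Prop :=
  Ext xi X Y = [set ext_class xi (ext0 X Y)].

Implicit Type P : set T * set T.

Definition cotorsion_pair xi P : Prop :=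
  P.2 = [set Z | forall X, P.1 X -> Ext_eq0 xi X Z] /\
  P.1 = [set Z | forall Y, P.2 Y -> Ext_eq0 xi Z Y].

Definition complete_pair xi P : Prop :=
  forall A : T,
    (exists (Y X : T) (u : hom Y X) (v : hom X A) (w : hom A (Sh T Y)),
       [/\ xi (Tri u v w), P.1 X & P.2 Y]) /\
    (exists (Y X : T) (u : hom A Y) (v : hom Y X) (w : hom X (Sh T A)),
       [/\ xi (Tri u v w), P.1 X & P.2 Y]).

Definition hereditary_pair xi P : Prop :=
  (forall (K X1 X2 : T) (u : hom K X1) (v : hom X1 X2) (w : hom X2 (Sh T K)),
     xi (Tri u v w) -> P.1 X1 -> P.1 X2 -> P.1 K) /\
  (forall (Y1 Y2 K : T) (u : hom Y1 Y2) (v : hom Y2 K) (w : hom K (Sh T Y1)),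
     xi (Tri u v w) -> P.2 Y1 -> P.2 Y2 -> P.2 K).

Definition right_approximation (om : set T) (W A : T) (f : hom W A) : Prop :=
  om W /\ forall (W' : T) (g : hom W' A), om W' ->
    exists h : hom W' W, g = f \oc h.

Definition contravariantly_finite (om : set T) : Prop :=
  forall A : T, exists (W : T) (f : hom W A), right_approximation om f.

Definition Omega xi : set (set T * set T) :=
  [set P | [/\ cotorsion_pair xi P, complete_pair xi P, hereditary_pair xi P
             & contravariantly_finite (P.1 `&` P.2)]].

(** * Model structures *)

Record morphism_classes := MorphismClasses {
  CoFib : forall X Y : T, set (hom X Y);
  Fib : forall X Y : T, set (hom X Y);
  Weq : forall X Y : T, set (hom X Y)
}.
Arguments CoFib M [X Y] f : rename.
Arguments Fib M [X Y] f : rename.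
Arguments Weq M [X Y] f : rename.

Implicit Type M : morphism_classes.

Definition two_out_of_three (W : forall X Y : T, set (hom X Y)) : Prop :=
  forall (X Y Z : T) (f : hom X Y) (g : hom Y Z),
    [/\ W _ _ f -> W _ _ g -> W _ _ (g \oc f),
        W _ _ f -> W _ _ (g \oc f) -> W _ _ g
      & W _ _ g -> W _ _ (g \oc f) -> W _ _ f].

Definition retract (A B A' B' : T) (f : hom A B) (g : hom A' B') : Prop :=
  exists (a : hom A A') (a' : hom A' A) (b : hom B B') (b' : hom B' B),
    [/\ a' \oc a = idm A, b' \oc b = idm B,
        g \oc a = b \oc f & f \oc a' = b' \oc g].

Definition closed_retracts (W : forall X Y : T, set (hom X Y)) : Prop :=
  forall (A B A' B' : T) (f : hom A B) (g : hom A' B'),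
    retract f g -> W _ _ g -> W _ _ f.

Definition has_lifting (A B X Y : T) (i : hom A B) (p : hom X Y) : Prop :=
  forall (a : hom A X) (b : hom B Y), p \oc a = b \oc i ->
    exists s : hom B X, s \oc i = a /\ p \oc s = b.

Record model_structure M : Prop := ModelStructure {
  ms_two_out_of_three : two_out_of_three (Weq M);
  ms_retract_CoFib : closed_retracts (CoFib M);
  ms_retract_Fib : closed_retracts (Fib M);
  ms_retract_Weq : closed_retracts (Weq M);
  ms_lifting : forall (A B X Y : T) (i : hom A B) (p : hom X Y),
    CoFib M i -> Fib M p -> Weq M i \/ Weq M p -> has_lifting i p;
  ms_factorization : forall (X Y : T) (f : hom X Y),
    (exists (E : T) (i : hom X E) (p : hom E Y),
       [/\ f = p \oc i, CoFib M i, Weq M i & Fib M p]) /\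
    (exists (E : T) (j : hom X E) (q : hom E Y),
       [/\ f = q \oc j, CoFib M j, Fib M q & Weq M q])
}.

Definition cofibrant M : set T := [set X | CoFib M (0 : hom zob X)].
Definition fibrant M : set T := [set X | Fib M (0 : hom X zob)].
Definition trivial M : set T := [set X | Weq M (0 : hom zob X)].
Definition trivially_fibrant M : set T := trivial M `&` fibrant M.

Definition weakly_projective xi M : Prop :=
  [/\ forall (X Y : T) (f : hom X Y),
        CoFib M f <-> proper_mono xi f /\ hocoker_in (cofibrant M) f,
      forall (X Y : T) (f : hom X Y),
        (Fib M f /\ Weq M f) <->
        proper_epi xi f /\ hoker_in (trivially_fibrant M) f
    & forall X : T, fibrant M X].

Definition Gamma xi : set morphism_classes :=
  [set M | model_structure M /\ weakly_projective xi M].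

(** * The correspondence *)

Definition CoFib_of xi P (A B : T) : set (hom A B) :=
  [set f | proper_mono xi f /\ hocoker_in P.1 f].

Definition Fib_of P (A B : T) : set (hom A B) :=
  [set f | forall W : T, (P.1 `&` P.2) W ->
           forall g : hom W B, exists h : hom W A, f \oc h = g].

Definition Weq_of xi P (A B : T) : set (hom A B) :=
  [set f | exists (W : T) (t : hom W B),
           [/\ (P.1 `&` P.2) W, proper_epi xi (copair f t)
             & hoker_in P.2 (copair f t)]].

Definition Phi xi P : morphism_classes :=
  MorphismClasses (CoFib_of xi P) (Fib_of P) (Weq_of xi P).

Definition Psi M : set T * set T := (cofibrant M, trivially_fibrant M).

End Triangulated.

(* Main.v *)
(* A xi-triangle is determined by its connecting morphism Z -> X[1], and the *)
(* morphisms w arising in this way form an ideal; saturation says that w     *)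
(* belongs to it as soon as w f does for a xi-proper epimorphism f.          *)
(* Ext_xi(Z, X) vanishes iff every such w : Z -> X[1] is zero.               *)
(*                                                                           *)
(* From cotorsion pairs to model structures, the crux is that f : A -> B is  *)
(* in Weq_omega iff it induces bijections Hom(C, A) -> Hom(C, B) modulo the  *)
(* morphisms factoring through omega, for all C in X. Two-out-of-three and   *)
(* closure under retracts are then immediate. The trivial cofibrations are   *)
(* retracts of inclusions A -> A (+) W with W in omega, the trivial          *)
(* fibrations are the xi-proper epimorphisms with hokernel in Y, and lifting *)
(* is a diagram chase using Ext_xi(X, Y) = 0.                                *)
(*                                                                           *)
(* Conversely, the factorizations of 0 -> A and A -> 0 give completeness and *)
(* the lifting property gives orthogonality. Since every object is fibrant,  *)
(* each trivial cofibration i splits, and its hocokernel is the hokernel of  *)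
(* a retraction of i, hence is in omega; so the fibrations and the weak      *)
(* equivalences are the prescribed ones.                                     *)

From mathcomp Require Import all_boot all_algebra.
From mathcomp Require Import boolp classical_sets functions.
Require Import Defs.

Set Implicit Arguments.
Unset Strict Implicit.
Unset Printing Implicit Defensive.

Import GRing.Theory.

Local Open Scope classical_set_scope.
Local Open Scope ring_scope.

(** For a cotorsion pair, completeness and the octahedral axiom give the factorization into a
    cofibration and a trivial fibration ([cofib_trivial_fibration_factorization]). Contravariant
    finiteness gives the other one: if [t] is a right omega-approximation of the target, then [f] is
    [in1] followed by the fibration [copair f t]. Heredity puts the hokernel of a suitable
    [copair f t] in Y, which yields the stable description [weq_ofP] of the weak equivalences;
    [fib_weq_ofP] then identifies the trivial fibrations. Hence [Gamma_Phi] and [Psi_Phi].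

    For a model structure, lifting and factorization produce the cotorsion pair ([Omega_Psi]). By
    [M_trivial_cofib_split] its trivial cofibrations are, up to isomorphism, inclusions A -> A (+) C
    with C in omega, and lifting against these is the condition defining [Fib_of]. This determines
    the fibrations and the weak equivalences, hence [Phi_Psi]. The bijection is formal from these
    four lemmas. *)

Section AdditiveCategories.
Variable C : additiveCategory.
Implicit Types A B X Y Z W : C.

(** * Additive categories and autoequivalences *)

Lemma comp0m X Y Z (f : hom X Y) : (0 : hom Y Z) \oc f = 0.
Proof. by apply: (addIr (0 \oc f)); rewrite -compDl !add0r. Qed.

Lemma compm0 X Y Z (g : hom Y Z) : g \oc (0 : hom X Y) = 0.
Proof. by apply: (addIr (g \oc 0)); rewrite -compDr !add0r. Qed.

Lemma compNm X Y Z (g : hom Y Z) (f : hom X Y) : - g \oc f = - (g \oc f).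
Proof. by apply: (addIr (g \oc f)); rewrite -compDl !addNr comp0m. Qed.

Lemma compmN X Y Z (g : hom Y Z) (f : hom X Y) : g \oc - f = - (g \oc f).
Proof. by apply: (addIr (g \oc f)); rewrite -compDr !addNr compm0. Qed.

Lemma compBl X Y Z (g g' : hom Y Z) (f : hom X Y) :
  (g - g') \oc f = g \oc f - g' \oc f.
Proof. by rewrite compDl compNm. Qed.

Lemma compBr X Y Z (g : hom Y Z) (f f' : hom X Y) :
  g \oc (f - f') = g \oc f - g \oc f'.
Proof. by rewrite compDr compmN. Qed.

Lemma zob_id0 : idm (@zob C) = 0.
Proof. exact: zob_initial. Qed.

Lemma copair_in1 A W B (f : hom A B) (t : hom W B) : copair f t \oc in1 = f.
Proof.
by rewrite /copair compDl -!compA pr1_in1 pr2_in1 compm0 compm1 addr0.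
Qed.

Lemma copair_in2 A W B (f : hom A B) (t : hom W B) : copair f t \oc in2 = t.
Proof.
by rewrite /copair compDl -!compA pr1_in2 pr2_in2 compm0 compm1 add0r.
Qed.

Lemma bip_ext A W B (g g' : hom (bip A W) B) :
  g \oc in1 = g' \oc in1 -> g \oc in2 = g' \oc in2 -> g = g'.
Proof.
move=> e1 e2; rewrite -[g]compm1 -[g']compm1 -bip_id !compDr !compA.
by rewrite e1 e2.
Qed.

Lemma comp_copair A W B D (g : hom B D) (f : hom A B) (t : hom W B) :
  g \oc copair f t = copair (g \oc f) (g \oc t).
Proof. by rewrite /copair compDr !compA. Qed.

Lemma copair_bipm A B A' B' D (f : hom A B) (g : hom A' B') (h : hom B D)
    (k : hom B' D) :
  copair h k \oc bipm f g = copair (h \oc f) (k \oc g).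
Proof.
by rewrite /bipm compDr !compA copair_in1 copair_in2.
Qed.

Lemma copair_in12 A W : copair in1 in2 = idm (bip A W).
Proof. exact: bip_id. Qed.

Lemma is_iso_id X : is_iso (idm X).
Proof. by exists (idm X); rewrite comp1m. Qed.

Lemma is_iso_opp X Y (f : hom X Y) : is_iso f -> is_iso (- f).
Proof.
by case=> g gf fg; exists (- g); rewrite compNm compmN opprK.
Qed.

Lemma is_iso_of_split X Y (f : hom X Y) (g : hom Y X) :
  is_iso (g \oc f) -> is_iso (f \oc g) -> is_iso f.
Proof.
case=> a a1 _ [b _ b2]; exists (a \oc g); first by rewrite -compA a1.
have e : a \oc g = g \oc b.
  by rewrite -[LHS]compm1 -b2 !compA -(compA a g f) a1 comp1m.
by rewrite e compA b2.
Qed.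

Lemma is_iso_unipotent X (n : hom X X) : n \oc n = 0 -> is_iso (idm X + n).
Proof.
move=> n2; exists (idm X - n).
  by rewrite compBl !compDr !comp1m !compm1 n2 addr0 addrK.
by rewrite compDl !compBr !comp1m !compm1 n2 subr0 subrK.
Qed.

Lemma copair_iso_split A B D (i : hom A B) (r : hom B A) (p : hom B D)
    (s : hom D B) :
  r \oc i = idm A -> p \oc s = idm D -> p \oc i = 0 -> r \oc s = 0 ->
  i \oc r + s \oc p = idm B -> is_iso (copair i s).
Proof.
move=> ri ps pi rs e; exists (in1 \oc r + in2 \oc p).
  rewrite comp_copair !compDl -!(compA _ _ i) -!(compA _ _ s) ri ps pi rs.
  by rewrite !compm0 !compm1 addr0 add0r copair_in12.
by rewrite compDr !compA copair_in1 copair_in2.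
Qed.

Section Endofunctors.
Variable S : endofunctor C.

Lemma fmap0 X Y : fmap S (0 : hom X Y) = 0.
Proof. by apply: (addIr (fmap S (0 : hom X Y))); rewrite -fmapD !add0r. Qed.

Lemma endo_zob_eq0 X (f : hom X (S zob)) : f = 0.
Proof. by rewrite -[f]comp1m -fmap1 zob_id0 fmap0 comp0m. Qed.

End Endofunctors.

Section Autoequivalences.
Variable S : autoequivalence C.
Notation Sh := (shift S).
Notation Un := (unshift S).

Lemma shift_unit X : fmap Sh (unit_ S X) = counitV S (Sh X).
Proof. by rewrite -[LHS]comp1m -counitK -compA shift_adj compm1. Qed.

Lemma shift_unitV X : fmap Sh (unitV S X) = counit S (Sh X).
Proof.
rewrite -[LHS]compm1 -[in LHS]counitK -shift_unit compA -fmapM unitK fmap1.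
by rewrite comp1m.
Qed.

Lemma shift_faithful X Y (f g : hom X Y) : fmap Sh f = fmap Sh g -> f = g.
Proof.
move=> e; rewrite -[f]comp1m -[g]comp1m -(unitK S) -!compA -!unit_nat.
by rewrite e.
Qed.

Lemma shift_full X Y (g : hom (Sh X) (Sh Y)) : exists f, fmap Sh f = g.
Proof.
exists (unitV S Y \oc fmap Un g \oc unit_ S X).
by rewrite !fmapM shift_unitV shift_unit counit_nat -compA counitVK compm1.
Qed.

Lemma is_iso_shift X Y (f : hom X Y) : is_iso (fmap Sh f) -> is_iso f.
Proof.
case=> g' gf fg; have [g eg] := shift_full g'; exists g;
  by apply: shift_faithful; rewrite fmapM fmap1 eg.
Qed.

Lemma counitV_iso X : is_iso (counitV S X).
Proof. by exists (counit S X); rewrite ?counitK ?counitVK. Qed.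

End Autoequivalences.

End AdditiveCategories.

(** * Triangulated categories: exactness, uniqueness of completions, split triangles *)

Section TriangulatedCategories.
Variable T : triangulatedCategory.
Implicit Types A B X Y Z W K L M N : T.
Local Notation dist u v w := (@distinguished T (Tri u v w)).
Local Notation "f [1]" := (fmap (Sh T) f) (at level 2, format "f [1]").

Lemma dist_iso X Y Z X' Y' Z' (u : hom X Y) (v : hom Y Z) (w : hom Z (Sh T X))
    (u' : hom X' Y') (v' : hom Y' Z') (w' : hom Z' (Sh T X'))
    (a : hom X X') (b : hom Y Y') (c : hom Z Z') :
  dist u v w -> is_iso a -> is_iso b -> is_iso c ->
  b \oc u = u' \oc a -> c \oc v = v' \oc b -> a[1] \oc w = w' \oc c ->
  dist u' v' w'.
Proof.
move=> d ia ib ic e1 e2 e3; apply: TR1_iso d.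
by exists a, b, c; split.
Qed.

Lemma TR3_homs X Y Z X' Y' Z' (u : hom X Y) (v : hom Y Z) (w : hom Z (Sh T X))
    (u' : hom X' Y') (v' : hom Y' Z') (w' : hom Z' (Sh T X'))
    (a : hom X X') (b : hom Y Y') :
  dist u v w -> dist u' v' w' -> b \oc u = u' \oc a ->
  exists2 c : hom Z Z', c \oc v = v' \oc b & a[1] \oc w = w' \oc c.
Proof.
move=> d d' e.
have [c [_ e2 e3]] := @TR3 T (Tri u v w) (Tri u' v' w') a b d d' e.
by exists c.
Qed.

(** Rotating both triangles reduces this to TR3. Since [1] is full and faithful, the resulting map
    on suspensions desuspends, and the signs cancel. *)
Lemma TR3_fibre X Y Z X' Y' Z' (u : hom X Y) (v : hom Y Z) (w : hom Z (Sh T X))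
    (u' : hom X' Y') (v' : hom Y' Z') (w' : hom Z' (Sh T X'))
    (b : hom Y Y') (c : hom Z Z') :
  dist u v w -> dist u' v' w' -> c \oc v = v' \oc b ->
  exists2 a : hom X X', b \oc u = u' \oc a & a[1] \oc w = w' \oc c.
Proof.
move=> /TR2 d /TR2 d' e; have [a1 e1 e2] := TR3_homs d d' e.
have [a ea] := shift_full a1; rewrite -ea in e1 e2.
exists a => //; apply: (@shift_faithful _ (susp T)); rewrite !fmapM.
by apply: oppr_inj; rewrite -compmN -compNm.
Qed.

Lemma TR3_middle X Y Z X' Y' Z' (u : hom X Y) (v : hom Y Z) (w : hom Z (Sh T X))
    (u' : hom X' Y') (v' : hom Y' Z') (w' : hom Z' (Sh T X'))
    (a : hom X X') (c : hom Z Z') :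
  dist u v w -> dist u' v' w' -> a[1] \oc w = w' \oc c ->
  exists2 b : hom Y Y', b \oc u = u' \oc a & c \oc v = v' \oc b.
Proof.
move=> /TR2 d /TR2 d' e; have [b e1 e2] := TR3_fibre d d' e.
exists b => //; apply: (@shift_faithful _ (susp T)); rewrite !fmapM.
by apply: oppr_inj; rewrite -compmN -compNm.
Qed.

Lemma dist_idm X : dist (idm X) (0 : hom X zob) 0.
Proof. exact: TR1_id. Qed.

Lemma dist_0idm X : dist (0 : hom zob X) (idm X) 0.
Proof.
apply/TR2; apply: (dist_iso (c := 0) (dist_idm X)); try exact: is_iso_id.
- by exists 0; rewrite ?(zob_initial (idm zob)) ?comp0m ?compm0 //;
    rewrite (endo_zob_eq0 (idm _)).
- by [].
- by rewrite !comp0m.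
- by rewrite fmap0 oppr0 compm0 comp0m.
Qed.

Lemma dist_comp X Y Z (u : hom X Y) (v : hom Y Z) (w : hom Z (Sh T X)) :
  dist u v w -> v \oc u = 0.
Proof.
move=> d; have [|c e _] := TR3_homs (a := idm X) (b := u) (dist_idm X) d.
  by [].
by rewrite -e compm0.
Qed.

Lemma dist_comp_vw X Y Z (u : hom X Y) (v : hom Y Z) (w : hom Z (Sh T X)) :
  dist u v w -> w \oc v = 0.
Proof. by move/TR2/dist_comp. Qed.

Lemma dist_comp_wu X Y Z (u : hom X Y) (v : hom Y Z) (w : hom Z (Sh T X)) :
  dist u v w -> u[1] \oc w = 0.
Proof.
by move/TR2/dist_comp_vw => e; apply: oppr_inj; rewrite -compNm e oppr0.
Qed.

(** This and the next four lemmas are the exactness of the Hom sequences of a triangle, obtained by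
    comparing it with a triangle on [idm A] and rotating. *)
Lemma factor_out_v X Y Z (u : hom X Y) (v : hom Y Z) (w : hom Z (Sh T X))
    A (g : hom Y A) : dist u v w -> g \oc u = 0 -> exists h, g = h \oc v.
Proof.
move=> d e; have [|h eh _] := TR3_homs (a := 0) (b := g) d (dist_0idm A).
  by rewrite e compm0.
by exists h; rewrite eh comp1m.
Qed.

Lemma factor_out_w X Y Z (u : hom X Y) (v : hom Y Z) (w : hom Z (Sh T X))
    A (g : hom Z A) : dist u v w -> g \oc v = 0 -> exists h, g = h \oc w.
Proof. by move/TR2; apply: factor_out_v. Qed.

Lemma factor_in_u X Y Z (u : hom X Y) (v : hom Y Z) (w : hom Z (Sh T X))
    A (g : hom A Y) : dist u v w -> v \oc g = 0 -> exists h, g = u \oc h.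
Proof.
move=> d e; have [|h eh _] := TR3_fibre (b := g) (c := 0) (dist_idm A) d.
  by rewrite e comp0m.
by exists h; rewrite -eh compm1.
Qed.

Lemma factor_in_v X Y Z (u : hom X Y) (v : hom Y Z) (w : hom Z (Sh T X))
    A (g : hom A Z) : dist u v w -> w \oc g = 0 -> exists h, g = v \oc h.
Proof. by move/TR2; apply: factor_in_u. Qed.

Lemma factor_in_w X Y Z (u : hom X Y) (v : hom Y Z) (w : hom Z (Sh T X))
    A (g : hom A (Sh T X)) :
  dist u v w -> u[1] \oc g = 0 -> exists h, g = w \oc h.
Proof.
by move=> /TR2 d e; apply: (factor_in_v d); rewrite compNm e oppr0.
Qed.

(** The morphism [c[1] \oc w] is the obstruction: when it vanishes, [c[1]] factors through [- u[1]],
    and the factor desuspends. *)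
Lemma extend_along X Y Z (u : hom X Y) (v : hom Y Z) (w : hom Z (Sh T X))
    A (c : hom X A) : dist u v w -> c[1] \oc w = 0 -> exists c', c = c' \oc u.
Proof.
move=> /TR2 d cw; have [s1 es] := factor_out_w d cw.
have [s es1] := shift_full (- s1); exists s.
apply: (@shift_faithful _ (susp T)); rewrite fmapM es1 es.
by rewrite compmN compNm.
Qed.

(** The fibre is the cone shifted by [-1]. *)
Lemma fibre_exists Y Z (v : hom Y Z) :
  exists X (u : hom X Y) (w : hom Z (Sh T X)), dist u v w.
Proof.
have [C [i [j d]]] := TR1_cone v.
have [u eu] := shift_full (- (j \oc counit (susp T) C)).
exists (Un T C), u, (counitV (susp T) C \oc i).
apply/TR2; apply: (dist_iso (c := counitV (susp T) C) d);
  try exact: is_iso_id.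
- exact: counitV_iso.
- by rewrite comp1m compm1.
- by rewrite compm1.
- by rewrite fmap1 comp1m eu opprK -compA counitVK compm1.
Qed.

Lemma middle_exists X Z (w : hom Z (Sh T X)) :
  exists Y (u : hom X Y) (v : hom Y Z), dist u v w.
Proof.
have [Y [v [b d]]] := fibre_exists w.
have [u eu] := shift_full (- b).
by exists Y, u, v; apply/TR2; rewrite eu opprK.
Qed.

(* Such an endomorphism differs from the identity by a square-zero one. *)
Lemma endo_cone_iso X Y Z (u : hom X Y) (v : hom Y Z) (w : hom Z (Sh T X))
    (c : hom Z Z) : dist u v w -> c \oc v = v -> w \oc c = w -> is_iso c.
Proof.
move=> d ev ew; have [|h eh] := @factor_out_w _ _ _ _ _ _ _ (c - idm Z) d.
  by rewrite compBl ev comp1m subrr.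
suff: is_iso (idm Z + (c - idm Z)) by rewrite addrC subrK.
apply: is_iso_unipotent; rewrite {1}eh -compA compBr ew compm1 subrr.
exact: compm0.
Qed.

Lemma endo_fibre_iso X Y Z (u : hom X Y) (v : hom Y Z) (w : hom Z (Sh T X))
    (a : hom X X) : dist u v w -> u \oc a = u -> a[1] \oc w = w -> is_iso a.
Proof.
move=> /TR2 d eu ew; apply: (@is_iso_shift _ (susp T)).
by apply: (endo_cone_iso d) => //; rewrite compNm -fmapM eu.
Qed.

Lemma endo_middle_iso X Y Z (u : hom X Y) (v : hom Y Z) (w : hom Z (Sh T X))
    (b : hom Y Y) : dist u v w -> b \oc u = u -> v \oc b = v -> is_iso b.
Proof.
move=> /TR2 d eu ev; apply: (endo_fibre_iso d) => //.
by rewrite compmN -fmapM eu.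
Qed.

(** The composite is only asked to be an isomorphism because the comparison maps from TR3 are not
    functorial: they compose to an endomorphism compatible with the triangle, not to the
    identity. *)
Definition iso_retract X Y : Prop :=
  exists (s : hom X Y) (r : hom Y X), is_iso (r \oc s).

Lemma cone_retract X Y Z X' Y' Z' (u : hom X Y) (v : hom Y Z)
    (w : hom Z (Sh T X)) (u' : hom X' Y') (v' : hom Y' Z')
    (w' : hom Z' (Sh T X')) :
  dist u v w -> dist u' v' w' -> retract u u' -> iso_retract Z Z'.
Proof.
move=> d d' [a [a' [b [b' [ea eb e e']]]]].
have [s s1 s2] := TR3_homs d d' (esym e).
have [r r1 r2] := TR3_homs d' d (esym e').
exists s, r; apply: (endo_cone_iso d).
- by rewrite -compA s1 compA r1 -compA eb compm1.
- by rewrite compA -r2 -compA -s2 compA -fmapM ea fmap1 comp1m.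
Qed.

Lemma fibre_retract X Y Z X' Y' Z' (u : hom X Y) (v : hom Y Z)
    (w : hom Z (Sh T X)) (u' : hom X' Y') (v' : hom Y' Z')
    (w' : hom Z' (Sh T X')) :
  dist u v w -> dist u' v' w' -> retract v v' -> iso_retract X X'.
Proof.
move=> d d' [a [a' [b [b' [ea eb e e']]]]].
have [s s1 s2] := TR3_fibre d d' (esym e).
have [r r1 r2] := TR3_fibre d' d (esym e').
exists s, r; apply: (endo_fibre_iso d).
- by rewrite compA -r1 -compA -s1 compA ea comp1m.
- by rewrite fmapM -compA s2 compA r2 -compA eb compm1.
Qed.

Lemma retract_refl X Y (f : hom X Y) : retract f f.
Proof.
by exists (idm X), (idm X), (idm Y), (idm Y); rewrite !comp1m !compm1.
Qed.

Lemma cone_unique X Y Z Z' (u : hom X Y) (v : hom Y Z) (w : hom Z (Sh T X))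
    (v' : hom Y Z') (w' : hom Z' (Sh T X)) :
  dist u v w -> dist u v' w' -> triangle_iso (Tri u v w) (Tri u v' w').
Proof.
move=> d d'.
have [|c c1 c2] := TR3_homs (a := idm X) (b := idm Y) d d'.
  by rewrite comp1m compm1.
have [|c' c1' c2'] := TR3_homs (a := idm X) (b := idm Y) d' d.
  by rewrite comp1m compm1.
rewrite ?compm1 ?fmap1 ?comp1m in c1 c2 c1' c2'.
exists (idm X), (idm Y), c; split; try exact: is_iso_id.
  by split => /=; rewrite ?fmap1 ?comp1m ?compm1.
apply: (@is_iso_of_split _ _ _ _ c').
  by apply: (endo_cone_iso d); rewrite -?compA ?c1 ?c1' // compA -c2'.
by apply: (endo_cone_iso d'); rewrite -?compA ?c1' ?c1 // compA -c2.
Qed.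

Lemma fibre_unique X X' Y Z (u : hom X Y) (v : hom Y Z) (w : hom Z (Sh T X))
    (u' : hom X' Y) (w' : hom Z (Sh T X')) :
  dist u v w -> dist u' v w' -> triangle_iso (Tri u v w) (Tri u' v w').
Proof.
move=> d d'.
have [|c c1 c2] := TR3_fibre (b := idm Y) (c := idm Z) d d'.
  by rewrite comp1m compm1.
have [|c' c1' c2'] := TR3_fibre (b := idm Y) (c := idm Z) d' d.
  by rewrite comp1m compm1.
rewrite ?compm1 ?fmap1 ?comp1m in c1 c2 c1' c2'.
exists c, (idm Y), (idm Z); split; try exact: is_iso_id.
  by split => /=; rewrite ?fmap1 ?comp1m ?compm1.
apply: (@is_iso_of_split _ _ _ _ c').
  by apply: (endo_fibre_iso d); rewrite ?fmapM ?compA -?c1' -?c1 // -compA c2.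
apply: (endo_fibre_iso d'); rewrite ?fmapM ?compA -?c1 -?c1' //.
by rewrite -compA c2'.
Qed.

Lemma middle_unique X Y Y' Z (u : hom X Y) (v : hom Y Z) (w : hom Z (Sh T X))
    (u' : hom X Y') (v' : hom Y' Z) :
  dist u v w -> dist u' v' w ->
  exists2 b : hom Y Y', is_iso b & b \oc u = u' /\ v = v' \oc b.
Proof.
move=> d d'.
have [|b b1 b2] := TR3_middle (a := idm X) (c := idm Z) d d'.
  by rewrite fmap1 comp1m compm1.
have [|b' b1' b2'] := TR3_middle (a := idm X) (c := idm Z) d' d.
  by rewrite fmap1 comp1m compm1.
rewrite ?compm1 ?comp1m in b1 b2 b1' b2'.
exists b => //; apply: (@is_iso_of_split _ _ _ _ b').
  by apply: (endo_middle_iso d); rewrite -?compA ?b1 ?b1' // compA -b2'.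
by apply: (endo_middle_iso d'); rewrite -?compA ?b1' ?b1 // compA -b2.
Qed.

(** The connecting morphism of the cone of [in1] vanishes because [in1] has a retraction; the map
    [p] from this cone to [B] induced by [pr2] is then inverse to [v \oc in2]. *)
Lemma dist_split A B : dist (@in1 T A B) (@pr2 T A B) 0.
Proof.
have [Z [v [w d]]] := TR1_cone (@in1 T A B).
have w0 : w = 0.
  rewrite -[w]comp1m -fmap1 -(pr1_in1 A B) fmapM -compA (dist_comp_wu d).
  exact: compm0.
have [p ep] := factor_out_v d (pr2_in1 A B).
have [|h eh] := factor_in_v (A := Z) (g := idm Z) d.
  by rewrite w0 comp0m.
have vE : v \oc in2 \oc p \oc v = v.
  rewrite -[RHS]compm1 -bip_id compDr !compA (dist_comp d) comp0m add0r.
  by rewrite -!compA -ep.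
have pi : is_iso p.
  exists (v \oc in2); last by rewrite compA -ep pr2_in2.
  by rewrite -[LHS]compm1 eh !compA vE.
apply: (dist_iso (c := p) d) => //; try exact: is_iso_id.
- by rewrite comp1m compm1.
- by rewrite compm1.
- by rewrite w0 compm0 comp0m.
Qed.

Lemma split_mono X Y Z (u : hom X Y) (v : hom Y Z) (w : hom Z (Sh T X))
    (r : hom Y X) : dist u v w -> r \oc u = idm X ->
  exists s : hom Z Y,
    [/\ v \oc s = idm Z, r \oc s = 0 & u \oc r + s \oc v = idm Y].
Proof.
move=> d ru.
have w0 : w = 0.
  rewrite -[w]comp1m -fmap1 -ru fmapM -compA (dist_comp_wu d).
  exact: compm0.
have [|s0 es0] := factor_in_v (A := Z) (g := idm Z) d.
  by rewrite w0 comp0m.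
(* Removing the component along [u] makes the section orthogonal to [r]. *)
pose s := s0 - u \oc r \oc s0.
have vs : v \oc s = idm Z.
  by rewrite compBr !compA (dist_comp d) !comp0m subr0 -es0.
have rs : r \oc s = 0 by rewrite compBr !compA ru comp1m subrr.
move: s vs rs => s vs rs; exists s; split=> //.
have [|t et] := factor_out_v (A := Y) (g := idm Y - (u \oc r + s \oc v)) d.
  rewrite compBl compDl -!compA ru (dist_comp d) compm0 compm1 comp1m addr0.
  exact: subrr.
have t0 : t = 0.
  rewrite -[t]compm1 -vs compA -et compBl compDl comp1m -!(compA _ _ s) rs vs.
  by rewrite compm0 compm1 add0r subrr.
by apply/esym/eqP; rewrite -subr_eq0 et t0 comp0m.
Qed.

Lemma dist_shift X Y Z (u : hom X Y) (v : hom Y Z) (w : hom Z (Sh T X)) :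
  dist (u[1]) (v[1]) (- w[1]) -> dist u v w.
Proof.
move=> d; do 3 apply/TR2.
apply: (dist_iso (b := - idm _) d); try exact: is_iso_id.
- exact/is_iso_opp/is_iso_id.
- by rewrite compNm comp1m compm1.
- by rewrite compNm compmN opprK comp1m compm1.
- by rewrite fmap1 comp1m compm1.
Qed.

Lemma dist_split_swap A B : dist (@in2 T A B) (@pr1 T A B) 0.
Proof.
have swapK X Y : copair in2 in1 \oc copair in2 in1 = idm (bip X Y).
  by rewrite comp_copair copair_in1 copair_in2 copair_in12.
apply: (dist_iso (b := copair in2 in1) (dist_split B A));
  try exact: is_iso_id.
- by exists (copair in2 in1).
- by rewrite copair_in1 compm1.
- apply: bip_ext; rewrite comp1m -compA ?copair_in1 ?copair_in2.
    by rewrite pr2_in1 pr1_in2.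
  by rewrite pr2_in2 pr1_in1.
- by rewrite compm0 comp0m.
Qed.

(* The octahedral axiom for the fibres instead of the cones of a composite. *)
Lemma TR4_fibres X Y Z K K' L (u : hom X Y) (v : hom Y Z)
    (a : hom K X) (a' : hom Y (Sh T K)) (b : hom L Y) (b' : hom Z (Sh T L))
    (c : hom K' X) (c' : hom Z (Sh T K')) :
  dist a u a' -> dist b v b' -> dist c (v \oc u) c' ->
  exists (f : hom K K') (g : hom K' L),
    dist f g (a' \oc b) /\ c \oc f = a.
Proof.
move=> /TR2 d1 /TR2 d2 /TR2 d3.
have [f1 [g1 [d _ e _ _]]] := TR4 d1 d2 d3.
have [f ef] := shift_full f1; have [g eg] := shift_full g1.
exists f, g; split.
  by apply: dist_shift; rewrite ef eg fmapM -compmN.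
apply: (@shift_faithful _ (susp T)); rewrite fmapM ef.
by apply: oppr_inj; rewrite -compNm.
Qed.

End TriangulatedCategories.

(** * Proper classes through their connecting morphisms *)

Section ProperClasses.
Variables (T : triangulatedCategory) (xi : set (tri T)).
Hypothesis hxi : proper_class xi.
Implicit Types A B X Y Z W K L M N : T.
Local Notation dist u v w := (@distinguished T (Tri u v w)).
Local Notation xit u v w := (xi (Tri u v w)).
Local Notation "f [1]" := (fmap (Sh T) f) (at level 2, format "f [1]").

Definition xi_phantom Z X (w : hom Z (Sh T X)) : Prop :=
  exists (Y : T) (u : hom X Y) (v : hom Y Z), xit u v w.

Lemma xi_dist X Y Z (u : hom X Y) (v : hom Y Z) (w : hom Z (Sh T X)) :
  xit u v w -> dist u v w.
Proof. exact: (pc_distinguished hxi). Qed.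

(** Two triangles with the same connecting morphism are isomorphic, so membership in [xi] depends on
    [w] alone. *)
Lemma xi_of_phantom X Y Z (u : hom X Y) (v : hom Y Z) (w : hom Z (Sh T X)) :
  dist u v w -> xi_phantom w -> xit u v w.
Proof.
move=> d [Y' [u' [v' h]]]; apply: (pc_iso hxi) (h).
have [b ib [e1 e2]] := middle_unique (xi_dist h) d.
exists (idm X), b, (idm Z); split=> //; try exact: is_iso_id.
by split => /=; rewrite ?fmap1 ?comp1m ?compm1.
Qed.

Lemma xi_of_mono X Y Z (u : hom X Y) (v : hom Y Z) (w : hom Z (Sh T X)) :
  dist u v w -> proper_mono xi u -> xit u v w.
Proof.
move=> d [Z' [v' [w' h]]]; apply: (pc_iso hxi) (h).
exact: cone_unique (xi_dist h) d.
Qed.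

Lemma proper_epiP Y Z (v : hom Y Z) :
  proper_epi xi v <-> exists X (u : hom X Y) (w : hom Z (Sh T X)), xit u v w.
Proof.
split=> [[X [a [b h]]]|[X [u [w h]]]]; first by do 3 eexists; exact: h.
exists (Sh T X), (u \oc unitV (susp T) X), w.
apply: (pc_iso hxi) (h).
exists (unit_ (susp T) X), (idm Y), (idm Z); split; try exact: is_iso_id.
- split=> /=; rewrite ?comp1m ?compm1 ?shift_unit //.
  by rewrite -compA unitK compm1.
- by exists (unitV (susp T) X); rewrite ?unitK ?unitVK.
Qed.

Lemma xi_of_epi X Y Z (u : hom X Y) (v : hom Y Z) (w : hom Z (Sh T X)) :
  dist u v w -> proper_epi xi v -> xit u v w.
Proof.
move=> d /proper_epiP[X' [u' [w' h]]]; apply: (pc_iso hxi) (h).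
exact: fibre_unique (xi_dist h) d.
Qed.

Lemma xi_mono X Y Z (u : hom X Y) (v : hom Y Z) (w : hom Z (Sh T X)) :
  xit u v w -> proper_mono xi u.
Proof. by move=> h; exists Z, v, w. Qed.

Lemma xi_epi X Y Z (u : hom X Y) (v : hom Y Z) (w : hom Z (Sh T X)) :
  xit u v w -> proper_epi xi v.
Proof. by move=> h; apply/proper_epiP; exists X, u, w. Qed.

Lemma xi_phan X Y Z (u : hom X Y) (v : hom Y Z) (w : hom Z (Sh T X)) :
  xit u v w -> xi_phantom w.
Proof. by move=> h; exists Y, u, v. Qed.

Lemma phantom_compr Z Z' X (w : hom Z (Sh T X)) (f : hom Z' Z) :
  xi_phantom w -> xi_phantom (w \oc f).
Proof.
move=> [Y [u [v h]]]; have [Y' [u' [v' d]]] := middle_exists (w \oc f).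
by exists Y', u', v'; apply: (pc_base_change hxi) h d.
Qed.

Lemma phantom_compl Z X X' (w : hom Z (Sh T X)) (f : hom X X') :
  xi_phantom w -> xi_phantom (f[1] \oc w).
Proof.
move=> [Y [u [v h]]]; have [Y' [u' [v' d]]] := middle_exists (f[1] \oc w).
by exists Y', u', v'; apply: (pc_cobase_change hxi) h d.
Qed.

Lemma phantom_compl_shift Z X X' (w : hom Z (Sh T X))
    (f : hom (Sh T X) (Sh T X')) :
  xi_phantom w -> xi_phantom (f \oc w).
Proof. by have [g <-] := shift_full f; apply: phantom_compl. Qed.

Lemma phantom0 Z X : xi_phantom (0 : hom Z (Sh T X)).
Proof.
exists (bip X Z), in1, pr2; apply: (pc_splitting hxi).
by split=> //; apply: dist_split.
Qed.

Lemma xi_split X Y Z (u : hom X Y) (v : hom Y Z) :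
  dist u v 0 -> xit u v 0.
Proof. by move=> d; apply: xi_of_phantom d (phantom0 _ _). Qed.

Lemma phantom_saturated Z Z' X (w : hom Z (Sh T X)) (f : hom Z' Z) :
  proper_epi xi f -> xi_phantom (w \oc f) -> xi_phantom w.
Proof.
move=> /proper_epiP[X' [x [y hf]]] [Y' [u' [v' h]]].
have [Y [u [v d]]] := middle_exists w.
by exists Y, u, v; apply: (pc_saturated hxi) d hf h.
Qed.

(* Pulling [w] back along the epimorphism of the triangle of [f[1] \oc w]     *)
(* makes it factor through the connecting morphism of [f].                    *)
Lemma phantom_cosaturated Z X X' (w : hom Z (Sh T X)) (f : hom X X') :
  proper_mono xi f -> xi_phantom (f[1] \oc w) -> xi_phantom w.
Proof.
move=> [C [p [g hf]]] [E [a [b h]]]; apply: (phantom_saturated (f := b)).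
  exact: xi_epi h.
have [|s ->] := factor_in_w (g := w \oc b) (xi_dist hf).
  by rewrite compA (dist_comp_vw (xi_dist h)).
exact/phantom_compr/xi_phan/hf.
Qed.

(** Let [w] be the connecting morphism of [g \oc f]. As [g[1]] kills [f[1] \oc w], the latter
    factors through the connecting morphism of [g]; cosaturation then removes [f[1]]. *)
Lemma proper_mono_comp X Y Z (f : hom X Y) (g : hom Y Z) :
  proper_mono xi f -> proper_mono xi g -> proper_mono xi (g \oc f).
Proof.
move=> hf [C [p [c hg]]]; have [D [q [w d]]] := TR1_cone (g \oc f).
exists D, q, w; apply: (xi_of_phantom d); apply: phantom_cosaturated hf _.
have [|s ->] := factor_in_w (g := f[1] \oc w) (xi_dist hg).
  by rewrite compA -fmapM (dist_comp_wu d).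
exact/phantom_compr/xi_phan/hg.
Qed.

Lemma proper_mono_cancel X Y Z (f : hom X Y) (g : hom Y Z) :
  proper_mono xi (g \oc f) -> proper_mono xi f.
Proof.
move=> hgf; have [D [q [w d]]] := TR1_cone f.
exists D, q, w; apply: (xi_of_phantom d); apply: phantom_cosaturated hgf _.
by rewrite fmapM -compA (dist_comp_wu d) compm0; apply: phantom0.
Qed.

Lemma proper_epi_comp X Y Z (f : hom X Y) (g : hom Y Z) :
  proper_epi xi f -> proper_epi xi g -> proper_epi xi (g \oc f).
Proof.
move=> /proper_epiP[K [k [c hf]]] hg.
have [D [q [w d]]] := fibre_exists (g \oc f).
apply: (@xi_epi _ _ _ q _ w); apply: (xi_of_phantom d).
apply: phantom_saturated hg _.
have [|s ->] := factor_out_w (g := w \oc g) (xi_dist hf).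
  by rewrite -compA (dist_comp_vw d).
exact/phantom_compl_shift/xi_phan/hf.
Qed.

Lemma proper_epi_cancel X Y Z (f : hom X Y) (g : hom Y Z) :
  proper_epi xi (g \oc f) -> proper_epi xi g.
Proof.
move=> hgf; have [D [q [w d]]] := fibre_exists g.
apply: (@xi_epi _ _ _ q _ w); apply: (xi_of_phantom d).
apply: phantom_saturated hgf _.
by rewrite compA (dist_comp_vw d) comp0m; apply: phantom0.
Qed.

Lemma split_proper_epi X Y (f : hom X Y) (s : hom Y X) :
  f \oc s = idm Y -> proper_epi xi f.
Proof.
move=> fs; apply: (@proper_epi_cancel _ _ _ s); rewrite fs.
exact/xi_epi/xi_split/dist_0idm.
Qed.

Lemma split_proper_mono X Y (f : hom X Y) (r : hom Y X) :
  r \oc f = idm X -> proper_mono xi f.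
Proof.
move=> rf; apply: (@proper_mono_cancel _ _ _ _ r); rewrite rf.
exact/xi_mono/xi_split/dist_idm.
Qed.

(** Equivalent extensions have the same connecting morphism, and [TR3_middle] makes extensions with
    the same connecting morphism equivalent. *)
Lemma Ext_eq0P X Y :
  Ext_eq0 xi X Y <-> forall w : hom X (Sh T Y), xi_phantom w -> w = 0.
Proof.
have hx0 : xi (ext_tri (ext0 X Y)) by apply: xi_split; apply: dist_split.
split=> [e0 w [E [u [v h]]]|e0].
  have : @Ext T xi X Y (ext_class xi (Extension u v w)).
    by exists (Extension u v w).
  rewrite e0 => /= e.
  have : ext_class xi (Extension u v w) (ext0 X Y).
    rewrite e; split=> //; exists (idm _).
    by split; rewrite ?fmap1 ?comp1m ?compm1.
  by move=> [_ [g [_ _ /=]]]; rewrite fmap1 comp1m comp0m.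
apply/seteqP; split=> [_ [e he <-]|_ ->]; last by exists (ext0 X Y).
have ecl0 (e1 : extension X Y) : xi (ext_tri e1) -> ecl e1 = 0.
  by move=> h1; apply: e0; apply: xi_phan h1.
have equiv (e1 e2 : extension X Y) :
    xi (ext_tri e1) -> xi (ext_tri e2) -> ext_equiv e1 e2.
  move=> h1 h2.
  have [|b b1 b2] :=
    TR3_middle (a := idm Y) (c := idm X) (xi_dist h1) (xi_dist h2).
    by rewrite !ecl0 // compm0 comp0m.
  by exists b; split=> //=; rewrite !ecl0 // compm0 comp0m.
by apply/seteqP; split=> e' [h' _]; split=> //; apply: equiv.
Qed.

Definition perp X Y : Prop := forall w : hom X (Sh T Y), xi_phantom w -> w = 0.

Lemma cotorsion_pairP (P : set T * set T) :
  cotorsion_pair xi P <->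
  (forall Z, P.2 Z <-> forall X, P.1 X -> perp X Z) /\
  (forall Z, P.1 Z <-> forall Y, P.2 Y -> perp Z Y).
Proof.
split=> [[e2 e1]|[e2 e1]].
  split=> Z.
    by rewrite e2; split=> h X /h /Ext_eq0P.
  by rewrite e1; split=> h Y /h /Ext_eq0P.
split; apply/seteqP; split=> Z.
- by move=> /e2 h X /h /Ext_eq0P.
- by move=> h; apply/e2 => X /h /Ext_eq0P.
- by move=> /e1 h X /h /Ext_eq0P.
- by move=> h; apply/e1 => X /h /Ext_eq0P.
Qed.

(** * Cotorsion pairs: closure properties, lifting and factorization *)

Section CotorsionPairs.
Variable P : set T * set T.
Local Notation XX := P.1.
Local Notation YY := P.2.
Local Notation om := (P.1 `&` P.2).
Hypothesis P_cotorsion : cotorsion_pair xi P.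

(** The intended description of the morphisms that are both fibrations and weak equivalences;
    [fib_weq_ofP] confirms it. *)
Definition trivial_fibration M N (q : hom M N) : Prop :=
  proper_epi xi q /\ hoker_in YY q.

Lemma XX_perp X Y : XX X -> YY Y -> perp X Y.
Proof.
move=> hX; have [/(_ Y) [h _] _] := (cotorsion_pairP P).1 P_cotorsion.
by move/h; apply.
Qed.

Lemma XX_of_perp Z : (forall Y, YY Y -> perp Z Y) -> XX Z.
Proof. by have [_ /(_ Z) [_ h]] := (cotorsion_pairP P).1 P_cotorsion. Qed.

Lemma YY_of_perp Z : (forall X, XX X -> perp X Z) -> YY Z.
Proof. by have [/(_ Z) [_ h] _] := (cotorsion_pairP P).1 P_cotorsion. Qed.

Lemma XX_retract A B : iso_retract A B -> XX B -> XX A.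
Proof.
move=> [s [r [g _ e]]] hB; apply: XX_of_perp => Y hY w hw.
rewrite -[w]compm1 -e !compA (XX_perp hB hY (w := w \oc r)) ?comp0m //.
exact: phantom_compr.
Qed.

Lemma YY_retract A B : iso_retract A B -> YY B -> YY A.
Proof.
move=> [s [r [g e _]]] hB; apply: YY_of_perp => X hX w hw.
rewrite -[w]comp1m -fmap1 -e !fmapM -!compA.
rewrite (XX_perp hX hB (w := s[1] \oc w)) ?compm0 //.
exact: phantom_compl.
Qed.

Lemma XX_zob : XX zob.
Proof. by apply: XX_of_perp => Y _ w _; apply: zob_initial. Qed.

Lemma YY_zob : YY zob.
Proof. by apply: YY_of_perp => X _ w _; apply: endo_zob_eq0. Qed.

Lemma XX_bip A B : XX A -> XX B -> XX (bip A B).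
Proof.
move=> hA hB; apply: XX_of_perp => Y hY w hw; apply: bip_ext; rewrite comp0m.
  by apply: (XX_perp hA hY); apply: phantom_compr.
by apply: (XX_perp hB hY); apply: phantom_compr.
Qed.

(** A phantom [e] out of [B] vanishes on [A], hence factors through [v]; by saturation the factor is
    again a phantom, so it vanishes on [C]. *)
Lemma XX_ext A B C (u : hom A B) (v : hom B C) (w : hom C (Sh T A)) :
  xit u v w -> XX A -> XX C -> XX B.
Proof.
move=> h hA hC; apply: XX_of_perp => Y hY e he.
have [|s es] := factor_out_v (g := e) (xi_dist h).
  by apply: (XX_perp hA hY); apply: phantom_compr.
have hs : xi_phantom s.
  by apply: (phantom_saturated (f := v)); rewrite -?es //; apply: xi_epi h.
by rewrite es (XX_perp hC hY hs) comp0m.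
Qed.

Lemma YY_ext A B C (u : hom A B) (v : hom B C) (w : hom C (Sh T A)) :
  xit u v w -> YY A -> YY C -> YY B.
Proof.
move=> h hA hC; apply: YY_of_perp => X hX e he.
have [s es] : exists s, e = u[1] \oc s.
  have d := xi_dist h; move/TR2/TR2 in d.
  have [|s es] := factor_in_v (g := e) d; last first.
    by exists (- s); rewrite es compNm compmN.
  rewrite compNm (XX_perp hX hC (w := v[1] \oc e)) ?oppr0 //.
  exact: phantom_compl.
have hs : xi_phantom s.
  by apply: (phantom_cosaturated (f := u)); rewrite -?es //; apply: xi_mono h.
by rewrite es (XX_perp hX hA hs) compm0.
Qed.

Lemma YY_bip A B : YY A -> YY B -> YY (bip A B).
Proof. exact: YY_ext (xi_split (dist_split A B)). Qed.

Lemma om_bip A B : om A -> om B -> om (bip A B).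
Proof.
by move=> [xA yA] [xB yB]; split; [apply: XX_bip | apply: YY_bip].
Qed.

Lemma cofib_of_xi A B C (f : hom A B) (p : hom B C) (w : hom C (Sh T A)) :
  xit f p w -> XX C -> CoFib_of xi P f.
Proof.
move=> h hC; split; first exact: xi_mono h.
by exists C => //; exists p, w; apply: xi_dist.
Qed.

(** Passes from the one hocokernel provided by the definition to an arbitrary chosen cone. *)
Lemma cofib_of_cone A B C (f : hom A B) (p : hom B C) (w : hom C (Sh T A)) :
  CoFib_of xi P f -> dist f p w -> xit f p w /\ XX C.
Proof.
move=> [hf [D [p' [w' d']] hD]] d; split; first exact: xi_of_mono d hf.
by apply: XX_retract hD; apply: cone_retract d d' (retract_refl f).
Qed.

Lemma trivial_fibration_of_xi A B K (a : hom K A) (f : hom A B)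
    (w : hom B (Sh T K)) :
  xit a f w -> YY K -> trivial_fibration f.
Proof.
move=> h hK; split; first exact: xi_epi h.
by exists K => //; exists a, w; apply: xi_dist.
Qed.

Lemma trivial_fibration_fibre A B K (a : hom K A) (f : hom A B)
    (w : hom B (Sh T K)) :
  trivial_fibration f -> dist a f w -> xit a f w /\ YY K.
Proof.
move=> [hf [D [p' [w' d']] hD]] d; split; first exact: xi_of_epi d hf.
by apply: YY_retract hD; apply: fibre_retract d d' (retract_refl f).
Qed.

Lemma cofib_of_retract A B A' B' (f : hom A B) (g : hom A' B') :
  retract f g -> CoFib_of xi P g -> CoFib_of xi P f.
Proof.
move=> fg hg; have [C [p [w d]]] := TR1_cone f.
have [D [p' [w' d']]] := TR1_cone g.
have [h' hD] := cofib_of_cone hg d'.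
apply: (@cofib_of_xi _ _ C _ p w).
  apply: (xi_of_mono d).
  have [a [a' [b [b' [ea eb e _]]]]] := fg.
  apply: (@proper_mono_cancel _ _ _ _ b); rewrite -e; apply: proper_mono_comp.
    exact: split_proper_mono ea.
  exact: xi_mono h'.
exact: XX_retract (cone_retract d d' fg) hD.
Qed.

Lemma trivial_fibration_retract A B A' B' (f : hom A B) (g : hom A' B') :
  retract f g -> trivial_fibration g -> trivial_fibration f.
Proof.
move=> fg hg; have [C [p [w d]]] := fibre_exists f.
have [D [p' [w' d']]] := fibre_exists g.
have [h' hD] := trivial_fibration_fibre hg d'.
apply: (@trivial_fibration_of_xi _ _ C p _ w).
  apply: (xi_of_epi d).
  have [a [a' [b [b' [ea eb _ e]]]]] := fg.
  apply: (@proper_epi_cancel _ _ _ a'); rewrite e; apply: proper_epi_comp.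
    exact: xi_epi h'.
  exact: split_proper_epi eb.
exact: YY_retract (fibre_retract d d' fg) hD.
Qed.

Lemma extend_along_cofib A B Y (f : hom A B) (c : hom A Y) :
  CoFib_of xi P f -> YY Y -> exists c', c = c' \oc f.
Proof.
move=> hf hY; have [C [p [w d]]] := TR1_cone f.
have [h hC] := cofib_of_cone hf d.
apply: (extend_along d); apply: (XX_perp hC hY).
exact/phantom_compl/xi_phan/h.
Qed.

Lemma lift_along_trivial_fibration X M N (q : hom M N) (h : hom X N) :
  trivial_fibration q -> XX X -> exists h', h = q \oc h'.
Proof.
move=> hq hX; have [K [a [w d]]] := fibre_exists q.
have [hx hK] := trivial_fibration_fibre hq d.
apply: (factor_in_v d); apply: (XX_perp hX hK).
exact/phantom_compr/xi_phan/hx.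
Qed.

(** The obstruction [w \oc b] to lifting [b] through [q] factors through the hocokernel of [i],
    where orthogonality kills it. The lift [t] fails to extend [a] by a map into the hokernel [K],
    and this error extends along [i] because [K] is in Y. *)
Lemma cofib_lifts_trivial_fibration A B M N (i : hom A B) (q : hom M N) :
  CoFib_of xi P i -> trivial_fibration q -> has_lifting i q.
Proof.
move=> hi hq a b e.
have [C [p [c d]]] := TR1_cone i; have [hc hC] := cofib_of_cone hi d.
have [K [k [w d']]] := fibre_exists q.
have [hw hK] := trivial_fibration_fibre hq d'.
have [|s es] := factor_out_v (g := w \oc b) d.
  by rewrite -compA -e compA (dist_comp_vw d') comp0m.
have s0 : s = 0.
  apply: (XX_perp hC hK); apply: (phantom_saturated (xi_epi hc)).
  by rewrite -es; apply/phantom_compr/xi_phan/hw.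
have [|t et] := factor_in_v (g := b) d'; first by rewrite es s0 comp0m.
have [|r er] := factor_in_u (g := a - t \oc i) d'.
  by rewrite compBr e compA -et subrr.
have [r' er'] := extend_along_cofib r hi hK.
exists (t + k \oc r'); split.
  by rewrite compDl -compA -er' -er addrC subrK.
by rewrite compDr compA (dist_comp d') comp0m addr0 et.
Qed.

(** A phantom [e] from the cone to an object of Y suspended is killed in stages: first on [B], then
    on [D]. It therefore comes from a map [A -> Y], which extends along [f] and [g] and so composes
    to zero with [w]. *)
Lemma cofib_of_comp A B D (f : hom A B) (g : hom B D) :
  CoFib_of xi P f -> CoFib_of xi P g -> CoFib_of xi P (g \oc f).
Proof.
move=> hf hg.
have [C [p [c d]]] := TR1_cone f; have [hc hC] := cofib_of_cone hf d.
have [C' [p' [c' d']]] := TR1_cone g; have [hc' hC'] := cofib_of_cone hg d'.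
have [E [k [w dE]]] := TR1_cone (g \oc f).
apply: (@cofib_of_xi _ _ E _ k w).
  apply: (xi_of_mono dE).
  exact: proper_mono_comp (xi_mono hc) (xi_mono hc').
apply: XX_of_perp => Y hY e he.
have ekg0 : e \oc k \oc g = 0.
  have [|s es] := factor_out_v (g := e \oc k \oc g) d.
    by rewrite -!compA (dist_comp dE) compm0.
  rewrite es (XX_perp hC hY (w := s)) ?comp0m //.
  apply: (phantom_saturated (xi_epi hc)).
  by rewrite -es; do 2 apply: phantom_compr.
have ek0 : e \oc k = 0.
  have [s es] := factor_out_v d' ekg0.
  rewrite es (XX_perp hC' hY (w := s)) ?comp0m //.
  apply: (phantom_saturated (xi_epi hc')).
  by rewrite -es; apply: phantom_compr.
have [t ->] := factor_out_w dE ek0; have [t' <-] := shift_full t.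
have [t1 ->] := extend_along_cofib t' hf hY.
have [t2 ->] := extend_along_cofib t1 hg hY.
by rewrite -compA fmapM -compA (dist_comp_wu dE) compm0.
Qed.

(** The homotopy pushout of [a] along [y], built by the octahedral axiom from [a \oc u] with [u] the
    fibre of [y]. The cofibrations [y] and [k] share the hocokernel [U[1]]. *)
Lemma cofib_of_pushout K M B Y (a : hom K M) (v : hom M B)
    (w : hom B (Sh T K)) (y : hom K Y) :
  xit a v w -> CoFib_of xi P y ->
  exists E (b : hom Y E) (q : hom E B) (k : hom M E),
    [/\ xit b q (y[1] \oc w), CoFib_of xi P k & q \oc k = v].
Proof.
move=> h hy; have [U [u [z d]]] := fibre_exists y.
have [hz hU] := cofib_of_cone hy ((TR2 _ _ _).1 d).
have [E [k [k' dk]]] := TR1_cone (a \oc u).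
have [b [q [dE _ _ e _]]] := TR4 d (xi_dist h) dk.
exists E, b, q, k; split=> //.
  by apply: (xi_of_phantom dE); apply/phantom_compl/xi_phan/h.
apply: (@cofib_of_xi _ _ (Sh T U) _ k' (- (a \oc u)[1])) => //.
apply: xi_of_phantom; first exact: (TR2 _ _ _).1 dk.
by rewrite fmapM -compmN; apply/phantom_compl/xi_phan/hz.
Qed.

Lemma cofib_of_in1 A X : XX X -> CoFib_of xi P (@in1 T A X).
Proof. exact: cofib_of_xi (xi_split (dist_split A X)). Qed.

Lemma dist_iso_zob X Y (f : hom X Y) : is_iso f -> dist (0 : hom zob X) f 0.
Proof.
move=> hf; apply: (dist_iso (a := idm zob) (c := f) (dist_0idm X)) => //;
  try exact: is_iso_id; by rewrite ?compm1 ?comp0m ?compm0.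
Qed.

Lemma trivial_fibration_iso X Y (f : hom X Y) : is_iso f -> trivial_fibration f.
Proof.
move=> hf; exact: trivial_fibration_of_xi (xi_split (dist_iso_zob hf)) YY_zob.
Qed.

Lemma trivial_fibration_comp_iso A M N (q : hom M N) (f : hom A M) :
  is_iso f -> trivial_fibration q -> trivial_fibration (q \oc f).
Proof.
move=> [g gf fg]; apply: trivial_fibration_retract.
by exists f, g, (idm N), (idm N); rewrite !comp1m -compA fg compm1.
Qed.

Hypothesis P_complete : complete_pair xi P.

Lemma trivial_fibration_onto A :
  exists X (v : hom X A), XX X /\ trivial_fibration v.
Proof.
have [[Y [X [u [v [w [h hX hY]]]]]] _] := P_complete A.
by exists X, v; split=> //; apply: trivial_fibration_of_xi h hY.
Qed.

Lemma cofib_of_into A : exists Y (u : hom A Y), YY Y /\ CoFib_of xi P u.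
Proof.
have [_ [Y [X [u [v [w [h hX hY]]]]]]] := P_complete A.
by exists Y, u; split=> //; apply: cofib_of_xi h hX.
Qed.

(** Adding a cover of [B] by an object of X turns [f] into a proper epimorphism; pushing out along
    an embedding of its hokernel into an object of Y makes it a trivial fibration. *)
Lemma cofib_trivial_fibration_factorization A B (f : hom A B) :
  exists E (j : hom A E) (q : hom E B),
    [/\ f = q \oc j, CoFib_of xi P j & trivial_fibration q].
Proof.
have [X [t [hX [ht _]]]] := trivial_fibration_onto B.
have hft : proper_epi xi (copair f t).
  by apply: (@proper_epi_cancel _ _ _ in2); rewrite copair_in2.
have [K [a [w d]]] := fibre_exists (copair f t).
have [Y [y [hY hy]]] := cofib_of_into K.
have [E [b [q [k [hq hk e]]]]] := cofib_of_pushout (xi_of_epi d hft) hy.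
exists E, (k \oc in1), q; split.
- by rewrite compA e copair_in1.
- by apply: cofib_of_comp => //; apply: cofib_of_in1.
- exact: trivial_fibration_of_xi hq hY.
Qed.

(** * The additive quotient by omega and the weak equivalences *)

Definition om_factors A B (h : hom A B) : Prop :=
  exists W (a : hom A W) (b : hom W B), om W /\ h = b \oc a.

Lemma om_factors0 A B : om_factors (0 : hom A B).
Proof.
exists zob, 0, 0; split; last by rewrite comp0m.
by split; [apply: XX_zob | apply: YY_zob].
Qed.

Lemma om_factors_compl A B D (h : hom A B) (g : hom B D) :
  om_factors h -> om_factors (g \oc h).
Proof.
by move=> [W [a [b [hW ->]]]]; exists W, a, (g \oc b); rewrite compA.
Qed.

Lemma om_factors_compr A B D (h : hom A B) (g : hom D A) :
  om_factors h -> om_factors (h \oc g).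
Proof.
by move=> [W [a [b [hW ->]]]]; exists W, (a \oc g), b; rewrite compA.
Qed.

Lemma om_factorsN A B (h : hom A B) : om_factors h -> om_factors (- h).
Proof. by rewrite -[- h]comp1m compmN -compNm; apply: om_factors_compl. Qed.

Lemma om_factorsD A B (h h' : hom A B) :
  om_factors h -> om_factors h' -> om_factors (h + h').
Proof.
move=> [W [a [b [hW ->]]]] [W' [a' [b' [hW' ->]]]].
exists (bip W W'), (in1 \oc a + in2 \oc a'), (copair b b').
split; first exact: om_bip.
by rewrite compDr !compA copair_in1 copair_in2.
Qed.

Lemma om_factorsB A B (h h' : hom A B) :
  om_factors h -> om_factors h' -> om_factors (h - h').
Proof. by move=> hh hh'; apply: om_factorsD => //; apply: om_factorsN. Qed.

(** The map lifts to an X-cover of [Y]; that cover is an extension of two objects of Y, so it lies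
    in omega. *)
Lemma om_factors_XX_YY X Y (h : hom X Y) : XX X -> YY Y -> om_factors h.
Proof.
move=> hX hY; have [X' [v [hX' hv]]] := trivial_fibration_onto Y.
have [h' ->] := lift_along_trivial_fibration h hv hX.
exists X', h', v; do 2 split=> //.
have [K [a [w d]]] := fibre_exists v.
have [hw hK] := trivial_fibration_fibre hv d.
exact: YY_ext hw hK hY.
Qed.

(* [f] induces bijections on the morphisms from objects of X in the additive  *)
(* quotient of T by omega = X /\ Y.                                           *)
Definition stably_bijective A B (f : hom A B) : Prop :=
  (forall X (g : hom X A), XX X -> om_factors (f \oc g) -> om_factors g) /\
  (forall X (h : hom X B), XX X -> exists g, om_factors (h - f \oc g)).

Lemma stably_bijective_comp A B D (f : hom A B) (g : hom B D) :
  stably_bijective f -> stably_bijective g -> stably_bijective (g \oc f).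
Proof.
move=> [fi fs] [gi gs]; split=> X h hX.
  by rewrite -compA => /(gi _ _ hX) /(fi _ _ hX).
have [h1 e1] := gs _ h hX; have [h2 e2] := fs _ h1 hX; exists h2.
have := om_factorsD e1 (om_factors_compl g e2).
by rewrite compBr !compA addrA subrK.
Qed.

Lemma stably_bijective_cancel_right A B D (f : hom A B) (g : hom B D) :
  stably_bijective f -> stably_bijective (g \oc f) -> stably_bijective g.
Proof.
move=> [fi fs] [gi gs]; split=> X h hX; last first.
  by have [k ek] := gs _ h hX; exists (f \oc k); rewrite compA.
have [k ek] := fs _ h hX => gh.
have : om_factors (g \oc f \oc k).
  have := om_factorsB gh (om_factors_compl g ek).
  by rewrite compBr opprB addrC subrK compA.
move/(gi _ _ hX)/(om_factors_compl f)/(om_factorsD ek).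
by rewrite subrK.
Qed.

Lemma stably_bijective_cancel_left A B D (f : hom A B) (g : hom B D) :
  stably_bijective g -> stably_bijective (g \oc f) -> stably_bijective f.
Proof.
move=> [gi gs] [hi hs]; split=> X h hX.
  by move/(om_factors_compl g); rewrite compA; apply: hi.
have [k ek] := hs _ (g \oc h) hX; exists k; apply: gi => //.
by rewrite compBr compA.
Qed.

Lemma stably_bijective_retract A B A' B' (f : hom A B) (g : hom A' B') :
  retract f g -> stably_bijective g -> stably_bijective f.
Proof.
move=> [a [a' [b [b' [ea eb e e']]]]] [gi gs]; split=> X h hX.
  move/(om_factors_compl b); rewrite compA -e -compA.
  by move/(gi _ _ hX)/(om_factors_compl a'); rewrite compA ea comp1m.
have [k ek] := gs _ (b \oc h) hX; exists (a' \oc k).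
by have := om_factors_compl b' ek; rewrite compBr !compA eb comp1m e'.
Qed.

Lemma stably_bijective_trivial_fibration M N (q : hom M N) :
  trivial_fibration q -> stably_bijective q.
Proof.
move=> hq; split=> X h hX; last first.
  have [k ek] := lift_along_trivial_fibration h hq hX.
  by exists k; rewrite ek subrr; apply: om_factors0.
move=> [W [a [b [hW e]]]].
have [b' eb] := lift_along_trivial_fibration b hq hW.1.
have [K [k [w d]]] := fibre_exists q.
have [hw hK] := trivial_fibration_fibre hq d.
(* Up to a map through [W], [h] comes from the hokernel [K] in Y, and every map from X to Y factors
   through omega. *)
have [|c ec] := factor_in_u (g := h - b' \oc a) d.
  by rewrite compBr e compA -eb subrr.
rewrite -[h](subrK (b' \oc a)) ec; apply: om_factorsD.
  exact/om_factors_compl/om_factors_XX_YY.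
by exists W, a, b'.
Qed.

Lemma stably_bijective_in1 A W : om W -> stably_bijective (@in1 T A W).
Proof.
move=> hW; split=> X h hX.
  by move/(om_factors_compl pr1); rewrite compA pr1_in1 comp1m.
exists (pr1 \oc h).
have -> : h - in1 \oc (pr1 \oc h) = in2 \oc (pr2 \oc h).
  by rewrite -{1}[h]comp1m -bip_id compDl !compA addrC addKr.
by exists W, (pr2 \oc h), in2.
Qed.

Lemma trivial_fibration_bipm A B A' B' (p : hom A B) (p' : hom A' B') :
  trivial_fibration p -> trivial_fibration p' -> trivial_fibration (bipm p p').
Proof.
move=> hp hp'; have [K [a [w d]]] := fibre_exists p.
have [hw hK] := trivial_fibration_fibre hp d.
have [K' [a' [w' d']]] := fibre_exists p'.
have [hw' hK'] := trivial_fibration_fibre hp' d'.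
exact: trivial_fibration_of_xi (pc_coproducts hxi hw hw') (YY_bip hK hK').
Qed.

Lemma stably_bijective_of_weq A B (f : hom A B) :
  Weq_of xi P f -> stably_bijective f.
Proof.
move=> [W [t [hW he hY]]]; rewrite -(copair_in1 f t).
apply: stably_bijective_comp; first exact: stably_bijective_in1.
exact: stably_bijective_trivial_fibration.
Qed.

(** Stable bijectivity gives a retraction [r0] of [i] up to a map through some [W] in omega; as [W]
    is in Y, that error extends along [i] and can be added to [r0]. For the resulting section [s],
    stable surjectivity makes [p \oc s], the identity of [C], factor through omega. *)
Lemma stably_bijective_cofib_split M M' C (i : hom M M') (p : hom M' C)
    (w : hom C (Sh T M)) :
  xit i p w -> XX M -> XX C -> stably_bijective i ->
  exists s : hom C M', om C /\ is_iso (copair i s).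
Proof.
move=> h hM hC [ii isur]; have hM' := XX_ext h hM hC.
have hi := cofib_of_xi h hC; have d := xi_dist h.
have [r0 er0] := isur _ (idm M') hM'.
have : om_factors (i \oc (idm M - r0 \oc i)).
  rewrite compBr compm1 -[in X in X - _](comp1m i) compA -compBl.
  exact: om_factors_compr.
move/(ii _ _ hM) => [W [a [b [hW e]]]].
have [a' ea] := extend_along_cofib a hi hW.2.
have ri : (r0 + b \oc a') \oc i = idm M.
  by rewrite compDl -compA -ea -e addrC subrK.
have [s [ps rs ips]] := split_mono d ri; exists s; split; last first.
  exact: copair_iso_split ri ps (dist_comp d) rs ips.
split=> //.
have [g /(om_factors_compl p)] := isur _ s hC.
rewrite compBr compA (dist_comp d) comp0m subr0 ps => -[W' [c [c' [hW' e']]]].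
by apply: YY_retract hW'.2; exists c, c'; rewrite -e'; apply: is_iso_id.
Qed.

Hypothesis P_hereditary : hereditary_pair xi P.

(* Replacing A by an X-object M over it and factoring the composite M -> B    *)
(* reduces to a stably bijective cofibration between X-objects, which splits; *)
(* this produces (f, t), whose hokernel is in Y by heredity.                  *)
Lemma weq_of_stably_bijective A B (f : hom A B) :
  stably_bijective f -> Weq_of xi P f.
Proof.
move=> hf; have [M [p [hM hp]]] := trivial_fibration_onto A.
have [M' [i [q [e hi hq]]]] := cofib_trivial_fibration_factorization (f \oc p).
have bi : stably_bijective i.
  apply: (stably_bijective_cancel_left (g := q)).
    exact: stably_bijective_trivial_fibration.
  rewrite -e; apply: stably_bijective_comp => //.
  exact: stably_bijective_trivial_fibration.
have [C [c [w d]]] := TR1_cone i; have [hw hC] := cofib_of_cone hi d.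
have [s [hom_C si]] := stably_bijective_cofib_split hw hM hC bi.
pose t := q \oc s; exists C, t.
have hid : trivial_fibration (idm C) by apply/trivial_fibration_iso/is_iso_id.
have hb := trivial_fibration_bipm hp hid.
have hft : trivial_fibration (copair f t \oc bipm p (idm C)).
  rewrite copair_bipm compm1 e /t -comp_copair.
  exact: trivial_fibration_comp_iso.
have eft : proper_epi xi (copair f t) by apply: proper_epi_cancel hft.1.
split=> //.
have [L [b [b' dL]]] := fibre_exists (copair f t).
exists L; first by exists b, b'.
have [K [a [a' dK]]] := fibre_exists (bipm p (idm C)).
have [hK yK] := trivial_fibration_fibre hb dK.
have [K' [k [k' dK']]] := fibre_exists (copair f t \oc bipm p (idm C)).
have [hK' yK'] := trivial_fibration_fibre hft dK'.
(* The octahedron gives a triangle [K -> K' -> L] whose first two terms are in Y; heredity applies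
   once [u] is a proper monomorphism. *)
have [u [v [du eu]]] := TR4_fibres dK dL dK'.
apply: P_hereditary.2 (xi_of_mono du _) yK yK'.
by apply: (@proper_mono_cancel _ _ _ _ k); rewrite eu; apply: xi_mono hK.
Qed.

Lemma weq_ofP A B (f : hom A B) : Weq_of xi P f <-> stably_bijective f.
Proof.
by split; [apply: stably_bijective_of_weq | apply: weq_of_stably_bijective].
Qed.

(** If [f] is a fibration, then [t] lifts through [f], which exhibits [f] as a retract of
    [copair f t]. *)
Lemma fib_weq_ofP A B (f : hom A B) :
  Fib_of P f /\ Weq_of xi P f <-> trivial_fibration f.
Proof.
split=> [[hf [W [t [hW he hY]]]]|hf].
  have [h eh] := hf W hW t.
  apply: (@trivial_fibration_retract _ _ _ _ _ (copair f t)) => //.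
  exists in1, (copair (idm A) h), (idm B), (idm B); rewrite !comp1m.
  by rewrite !copair_in1 comp_copair compm1 eh.
split; last exact/weq_ofP/stably_bijective_trivial_fibration.
move=> W hW g; have [h ->] := lift_along_trivial_fibration g hf hW.1.
by exists h.
Qed.

(* Such an [i] is a retract of A -> A (+) W by the retract argument. *)
Lemma cofib_weq_of_lifts A B M N (i : hom A B) (p : hom M N) :
  CoFib_of xi P i -> Weq_of xi P i -> Fib_of P p -> has_lifting i p.
Proof.
move=> hi [W [t [hW he hY]]] hp a b e.
have [|s [s1 s2]] :=
  cofib_lifts_trivial_fibration hi (conj he hY) (a := in1) (b := idm B).
  by rewrite copair_in1 comp1m.
have [h eh] := hp W hW (b \oc t).
exists (copair a h \oc s); split; first by rewrite -compA s1 copair_in1.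
by rewrite compA comp_copair e eh -comp_copair -compA s2 compm1.
Qed.

(** * The model structure of a cotorsion pair *)

Hypothesis om_contravariantly_finite : contravariantly_finite om.

Lemma model_structure_Phi : model_structure (Phi xi P).
Proof.
have weqE A B (f : hom A B) : Weq_of xi P f = stably_bijective f.
  exact/propext/weq_ofP.
split=> /=.
- move=> A B D f g /=; rewrite !weqE; split.
  + exact: stably_bijective_comp.
  + exact: stably_bijective_cancel_right.
  + exact: stably_bijective_cancel_left.
- by move=> A B A' B' f g; apply: cofib_of_retract.
- move=> A B A' B' f g [a [a' [b [b' [ea eb e e']]]]] hg W hW h.
  have [k ek] := hg W hW (b \oc h); exists (a' \oc k).
  by rewrite compA e' -compA ek compA eb comp1m.
- move=> A B A' B' f g fg /=; rewrite !weqE.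
  exact: stably_bijective_retract.
- move=> A B M N i p hi hp [wi|wp]; first exact: cofib_weq_of_lifts.
  by apply: cofib_lifts_trivial_fibration => //; apply/fib_weq_ofP.
- move=> A B f; split.
    have [W [t [hW ht]]] := om_contravariantly_finite B.
    exists (bip A W), in1, (copair f t); split.
    + by rewrite copair_in1.
    + exact/cofib_of_in1/hW.1.
    + exact/weq_ofP/stably_bijective_in1.
    + move=> W' hW' g; have [h ->] := ht W' g hW'.
      by exists (in2 \oc h); rewrite compA copair_in2.
  have [E [j [q [e hj /fib_weq_ofP[fq wq]]]]] :=
    cofib_trivial_fibration_factorization f.
  by exists E, j, q.
Qed.

Lemma cofibrant_Phi : cofibrant (Phi xi P) = XX.
Proof.
apply/seteqP; split=> X /= h.
  exact: (cofib_of_cone h (dist_0idm X)).2.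
exact: cofib_of_xi (xi_split (dist_0idm X)) h.
Qed.

Lemma fibrant_Phi X : fibrant (Phi xi P) X.
Proof. by move=> W _ g; exists 0; rewrite comp0m (zob_terminal g). Qed.

Lemma trivially_fibrant_Phi : trivially_fibrant (Phi xi P) = YY.
Proof.
apply/seteqP; split=> Y.
  move=> [[W [t [hW he hY]]] _].
  have [K [a [w d]]] := fibre_exists (copair (0 : hom zob Y) t).
  have [hw hK] := trivial_fibration_fibre (conj he hY) d.
  (* Here [Y] is the third term of a xi-triangle [K -> 0 (+) W -> Y] with [K] and [W] in Y. *)
  by apply: P_hereditary.2 hw hK _; apply: YY_bip YY_zob hW.2.
move=> hY; split; last exact: fibrant_Phi.
apply/weq_ofP; split=> X g hX.
  by move=> _; rewrite (zob_terminal g); apply: om_factors0.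
by exists 0; rewrite comp0m subr0; apply: om_factors_XX_YY.
Qed.

Lemma Psi_Phi : Psi (Phi xi P) = P.
Proof.
by rewrite /Psi cofibrant_Phi trivially_fibrant_Phi -surjective_pairing.
Qed.

Lemma Gamma_Phi : Gamma xi (Phi xi P).
Proof.
split; first exact: model_structure_Phi.
split; last exact: fibrant_Phi.
- by rewrite cofibrant_Phi.
- by rewrite trivially_fibrant_Phi => A B f; apply: fib_weq_ofP.
Qed.

End CotorsionPairs.

(** * The cotorsion pair of a weakly projective model structure *)

Section ModelStructures.
Variable M : morphism_classes T.
Hypothesis M_model : model_structure M.
Hypothesis M_projective : weakly_projective xi M.
Local Notation CC := (cofibrant M).
Local Notation TF := (trivially_fibrant M).

(** The identity is a retract of the trivial fibration in its own factorization. *)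
Lemma weq_idm X : Weq M (idm X).
Proof.
have [_ [E [j [q [e _ _ hq]]]]] := ms_factorization M_model (idm X).
apply: (ms_retract_Weq M_model) hq.
by exists j, q, (idm X), (idm X); rewrite !comp1m ?compm1 -e.
Qed.

Lemma trivialP X : trivial M X <-> Weq M (0 : hom X zob).
Proof.
have e : (0 : hom X zob) \oc (0 : hom zob X) = idm zob.
  by rewrite comp0m zob_id0.
have [_ h1 h2] := ms_two_out_of_three M_model (0 : hom zob X) (0 : hom X zob).
rewrite e in h1 h2.
by split=> h; [apply: h1 => // | apply: h2 => //]; apply: weq_idm.
Qed.

Lemma retract_zob A B (s : hom A B) (r : hom B A) :
  r \oc s = idm A -> retract (0 : hom zob A) (0 : hom zob B).
Proof.
move=> rs; exists (idm zob), (idm zob), s, r.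
by rewrite !comp1m !compm0 !comp0m.
Qed.

Lemma cofibrant_retract A B (s : hom A B) (r : hom B A) :
  r \oc s = idm A -> CC B -> CC A.
Proof. by move=> rs; apply: (ms_retract_CoFib M_model) (retract_zob rs). Qed.

Lemma M_fibrant X : fibrant M X.
Proof. by case: M_projective. Qed.

Lemma trivially_fibrant_retract A B (s : hom A B) (r : hom B A) :
  r \oc s = idm A -> TF B -> TF A.
Proof.
move=> rs [hB _]; split; last exact: M_fibrant.
exact: (ms_retract_Weq M_model) (retract_zob rs) hB.
Qed.

Lemma iso_retractP A B : iso_retract A B ->
  exists (s : hom A B) (r : hom B A), r \oc s = idm A.
Proof. by move=> [s [r [g e _]]]; exists s, (g \oc r); rewrite -compA. Qed.

Lemma M_cofib_cone A B C (f : hom A B) (p : hom B C) (w : hom C (Sh T A)) :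
  CoFib M f -> dist f p w -> xit f p w /\ CC C.
Proof.
have [hcof _ _] := M_projective.
move=> /hcof[hf [D [p' [w' d']] hD]] d; split; first exact: xi_of_mono d hf.
have [s [r rs]] := iso_retractP (cone_retract d d' (retract_refl f)).
exact: cofibrant_retract rs hD.
Qed.

Lemma M_tfib_fibre A B K (a : hom K A) (f : hom A B) (w : hom B (Sh T K)) :
  Fib M f -> Weq M f -> dist a f w -> xit a f w /\ TF K.
Proof.
have [_ htf _] := M_projective.
move=> ff wf; have /htf[hf [D [p' [w' d']] hD]] := conj ff wf.
move=> d; split; first exact: xi_of_epi d hf.
have [s [r rs]] := iso_retractP (fibre_retract d d' (retract_refl f)).
exact: trivially_fibrant_retract rs hD.
Qed.

Lemma M_tfib_of_xi A B K (a : hom K A) (f : hom A B) (w : hom B (Sh T K)) :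
  xit a f w -> TF K -> Fib M f /\ Weq M f.
Proof.
have [_ htf _] := M_projective.
move=> h hK; apply/htf; split; first exact: xi_epi h.
by exists K => //; exists a, w; apply: xi_dist.
Qed.

(** The second map of a triangle with connecting morphism [w] is a trivial fibration; lifting
    [0 -> X] against it gives a section, so [w] vanishes. *)
Lemma M_perp X Z : CC X -> TF Z -> perp X Z.
Proof.
move=> hX hZ w [E [u [v h]]]; have [fv wv] := M_tfib_of_xi h hZ.
have [|s [_ es]] :=
  ms_lifting M_model hX fv (or_intror wv) (a := 0) (b := idm X).
  by rewrite !compm0.
by rewrite -[w]compm1 -es compA (dist_comp_vw (xi_dist h)) comp0m.
Qed.

Lemma M_cofibrant_cover A :
  exists E (q : hom E A), [/\ CC E, Fib M q & Weq M q].
Proof.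
have [_ [E [j [q [_ hj fq wq]]]]] := ms_factorization M_model (0 : hom zob A).
by exists E, q; rewrite (zob_initial j) in hj.
Qed.

Lemma M_tf_envelope A : exists E (j : hom A E), CoFib M j /\ TF E.
Proof.
have [_ [E [j [q [_ hj fq wq]]]]] := ms_factorization M_model (0 : hom A zob).
exists E, j; split=> //; split; last exact: M_fibrant.
by apply/trivialP; rewrite (zob_terminal q) in wq.
Qed.

Lemma M_cofibrant_of_perp X : (forall Z, TF Z -> perp X Z) -> CC X.
Proof.
move=> h; have [E [q [hE fq wq]]] := M_cofibrant_cover X.
have [K [a [w d]]] := fibre_exists q; have [hw hK] := M_tfib_fibre fq wq d.
have [|s es] := factor_in_v (g := idm X) d.
  by rewrite (h K hK w (xi_phan hw)) comp0m.
exact: cofibrant_retract (esym es) hE.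
Qed.

Lemma M_tf_of_perp Z : (forall X, CC X -> perp X Z) -> TF Z.
Proof.
move=> h; have [E [j [hj hE]]] := M_tf_envelope Z.
have [C [p [w d]]] := TR1_cone j; have [hw hC] := M_cofib_cone hj d.
have [|r er] := extend_along (c := idm Z) d.
  by rewrite (h C hC w (xi_phan hw)) compm0.
exact: trivially_fibrant_retract (esym er) hE.
Qed.

Lemma Psi_cotorsion : cotorsion_pair xi (Psi M).
Proof.
apply/cotorsion_pairP; split=> Z; split=> /= h.
- by move=> X hX; apply: M_perp.
- exact: M_tf_of_perp.
- by move=> Y hY; apply: M_perp.
- exact: M_cofibrant_of_perp.
Qed.

Lemma Psi_complete : complete_pair xi (Psi M).
Proof.
move=> A; split.
  have [E [q [hE fq wq]]] := M_cofibrant_cover A.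
  have [K [a [w d]]] := fibre_exists q; have [hw hK] := M_tfib_fibre fq wq d.
  by exists K, E, a, q, w.
have [E [j [hj hE]]] := M_tf_envelope A.
have [C [p [w d]]] := TR1_cone j; have [hw hC] := M_cofib_cone hj d.
by exists E, C, j, p, w.
Qed.

Lemma M_tf_coresolving Y1 Y2 K (u : hom Y1 Y2) (v : hom Y2 K)
    (w : hom K (Sh T Y1)) : xit u v w -> TF Y1 -> TF Y2 -> TF K.
Proof.
move=> h h1 [h2 _]; split; last exact: M_fibrant.
have [fv wv] := M_tfib_of_xi h h1.
have [hc _ _] := ms_two_out_of_three M_model (0 : hom zob Y2) v.
by move: hc; rewrite compm0; apply.
Qed.

(* An extension of K by a trivially fibrant Z is pulled back from one of a    *)
(* trivially fibrant Y'' along a map K -> Y'', which extends to X1.           *)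
Lemma M_cofibrant_resolving K X1 X2 (u : hom K X1) (v : hom X1 X2)
    (w : hom X2 (Sh T K)) : xit u v w -> CC X1 -> CC X2 -> CC K.
Proof.
move=> h h1 h2; apply: M_cofibrant_of_perp => Z hZ phi [E [a [e hE]]].
have [Y' [y [hy hY']]] := M_tf_envelope E.
have [D [p [c dy]]] := TR1_cone y; have [hc hD] := M_cofib_cone hy dy.
have [Y'' [k [psi dk]]] := TR1_cone (y \oc a).
have hk : xit (y \oc a) k psi.
  apply: (xi_of_mono dk).
  exact: proper_mono_comp (xi_mono hE) (xi_mono hc).
have hY'' := M_tf_coresolving hk hZ hY'.
have [f [_ [_ _ <- _ _]]] := TR4 (xi_dist hE) dy dk.
have [|f' ->] := extend_along (c := f) (xi_dist h).
  exact: (M_perp h2 hY'') (phantom_compl _ (xi_phan h)).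
rewrite compA (M_perp h1 hZ (w := psi \oc f')) ?comp0m //.
exact/phantom_compr/xi_phan/hk.
Qed.

(** Factor [0 -> A] as a trivial cofibration and a fibration: the middle object lies in omega, and
    lifting makes the fibration an approximation. *)
Lemma Psi_contravariantly_finite : contravariantly_finite (CC `&` TF).
Proof.
move=> A.
have [[W [i [p [_ hi wi fp]]]] _] := ms_factorization M_model (0 : hom zob A).
rewrite (zob_initial i) in hi wi.
exists W, p; split; first by split=> //; split=> //; apply: M_fibrant.
move=> W' g [hW' [wW' _]].
have [|s [_ es]] :=
  ms_lifting M_model hW' fp (or_introl wW') (a := 0) (b := g).
  by rewrite !compm0.
by exists s.
Qed.

Lemma Omega_Psi : Omega xi (Psi M).
Proof.
split.
- exact: Psi_cotorsion.
- exact: Psi_complete.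
- by split=> /=; [apply: M_cofibrant_resolving | apply: M_tf_coresolving].
- exact: Psi_contravariantly_finite.
Qed.

Lemma M_fib_of_lifting A B (f : hom A B) :
  (forall X Y (i : hom X Y), CoFib M i -> Weq M i -> has_lifting i f) ->
  Fib M f.
Proof.
move=> h; have [[E [i [p [e hi wi fp]]]] _] := ms_factorization M_model f.
have [|s [s1 s2]] := h _ _ i hi wi (idm A) p; first by rewrite compm1.
apply: (ms_retract_Fib M_model) fp.
by exists i, s, (idm B), (idm B); rewrite !comp1m -e s1 s2.
Qed.

(* A trivial cofibration splits because its source is fibrant; its hocokernel *)
(* is the hokernel of a retraction, which is a trivial fibration.             *)
Lemma M_trivial_cofib_split A B (i : hom A B) :
  CoFib M i -> Weq M i ->
  exists C (s : hom C B), (CC `&` TF) C /\ is_iso (copair i s).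
Proof.
move=> hi wi; have [C [p [w d]]] := TR1_cone i.
have [hw hC] := M_cofib_cone hi d.
have [|r [ri _]] :=
  ms_lifting M_model hi (M_fibrant A) (or_introl wi) (a := idm A) (b := 0).
  by rewrite !comp0m.
have [s [ps rs ips]] := split_mono d ri; exists C, s; split; last first.
  exact: copair_iso_split ri ps (dist_comp d) rs ips.
split=> //.
have wr : Weq M r.
  have [_ h _] := ms_two_out_of_three M_model i r.
  by apply: h => //; rewrite ri; apply: weq_idm.
(* Since [B] is the sum of [A] and [C], a lift against [r] amounts to one into [C], which exists
   because [C] is fibrant. *)
have fr : Fib M r.
  apply: M_fib_of_lifting => X Y j hj wj a b e.
  have [|c [ec _]] :=
    ms_lifting M_model hj (M_fibrant C) (or_introl wj) (a := p \oc a) (b := 0).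
    by rewrite !comp0m.
  exists (i \oc b + s \oc c); split.
    by rewrite compDl -!compA ec -e !compA -compDl ips comp1m.
  by rewrite compDr !compA ri rs comp0m comp1m addr0.
have [K [a [b dK]]] := fibre_exists r; have [_ hK] := M_tfib_fibre fr wr dK.
(* As [r \oc s = 0], the section [s] factors through the hokernel of [r], and [C] becomes a retract
   of it. *)
have [l el] := factor_in_u dK rs.
by apply: (trivially_fibrant_retract (s := l) (r := p \oc a)) hK;
  rewrite -compA -el.
Qed.

Lemma M_fibP A B (f : hom A B) : Fib M f <-> Fib_of (Psi M) f.
Proof.
split=> [ff W [hW [wW _]] g|hf].
  have [|s [_ es]] :=
    ms_lifting M_model hW ff (or_introl wW) (a := 0) (b := g).
    by rewrite !compm0.
  by exists s.
apply: M_fib_of_lifting => X Y i hi wi a b e.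
have [C [s [hC [g gi ig]]]] := M_trivial_cofib_split hi wi.
have [h eh] := hf C hC (b \oc s).
exists (copair a h \oc g); split.
  by rewrite -(copair_in1 i s) compA -(compA _ g) gi compm1 copair_in1.
by rewrite compA comp_copair e eh -comp_copair -compA ig compm1.
Qed.

(** If [f] is [p \oc i] with [i] a trivial cofibration, split as [copair i s], then
    [copair f (p \oc s)] is isomorphic to the trivial fibration [p]. Conversely [f] is
    [copair f t \oc in1], and [in1] is a weak equivalence because [pr1], with hokernel [W], is a
    trivial fibration. *)
Lemma M_weqP A B (f : hom A B) : Weq M f <-> Weq_of xi (Psi M) f.
Proof.
have [_ htf _] := M_projective; split=> [wf|[W [t [hW he hY]]]].
  have [[E [i [p [e hi wi fp]]]] _] := ms_factorization M_model f.
  have wp : Weq M p.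
    have [_ h _] := ms_two_out_of_three M_model i p.
    by apply: h => //; rewrite -e.
  have [C [s [hC [g gi ig]]]] := M_trivial_cofib_split hi wi.
  have rp : retract (copair f (p \oc s)) p.
    exists (copair i s), g, (idm B), (idm B).
    rewrite !comp1m e -comp_copair; split=> //.
    by rewrite -compA ig compm1.
  have [h1 h2] : proper_epi xi (copair f (p \oc s)) /\
                 hoker_in TF (copair f (p \oc s)).
    apply/htf; split.
      exact: (ms_retract_Fib M_model) rp fp.
    exact: (ms_retract_Weq M_model) rp wp.
  by exists C, (p \oc s).
have [_ wft] := (htf _ _ _).2 (conj he hY).
have [_ wp] := M_tfib_of_xi (xi_split (dist_split_swap A W)) hW.2.
have win : Weq M (@in1 T A W).
  have [_ _ h] := ms_two_out_of_three M_model (@in1 T A W) pr1.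
  by apply: h => //; rewrite pr1_in1; apply: weq_idm.
have [h _ _] := ms_two_out_of_three M_model in1 (copair f t).
by move: h; rewrite copair_in1; apply.
Qed.

Lemma Phi_Psi : Phi xi (Psi M) = M.
Proof.
have [hcof _ _] := M_projective.
have ext (F G : forall X Y : T, set (hom X Y)) :
    (forall X Y (f : hom X Y), F X Y f <-> G X Y f) -> F = G.
  move=> h; do 3 (apply: functional_extensionality_dep => ?).
  exact/propext/h.
rewrite /Phi; case: (M) M_fibP M_weqP hcof => c fb wq /= hf hw hc.
congr MorphismClasses; apply: ext => X Y f; split.
- by move/hc.
- by move/hc.
- by move/hf.
- by move/hf.
- by move/hw.
- by move/hw.
Qed.

End ModelStructures.

End ProperClasses.

Theorem theorem1p7 (T : triangulatedCategory) (xi : set (tri T))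
    (hxi : proper_class xi) :
  set_bij (Omega xi) (Gamma xi) (Phi xi) /\
  (forall M, Gamma xi M -> Omega xi (Psi M)) /\
  (forall P, Omega xi P -> Psi (Phi xi P) = P) /\
  (forall M, Gamma xi M -> Phi xi (Psi M) = M).
Proof.
have PhiP P : Omega xi P -> Gamma xi (Phi xi P).
  by case=> hc hp hh hf; apply: Gamma_Phi.
have PsiM M : Gamma xi M -> Omega xi (Psi M).
  by case=> hm hp; apply: Omega_Psi.
have PsiPhi P : Omega xi P -> Psi (Phi xi P) = P.
  by case=> hc hp hh _; apply: Psi_Phi.
have PhiPsi M : Gamma xi M -> Phi xi (Psi M) = M.
  by case=> hm hp; apply: Phi_Psi.
split; last by split.
split.
- exact: PhiP.
- move=> P Q /set_mem hP /set_mem hQ e.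
  by rewrite -(PsiPhi P hP) -(PsiPhi Q hQ) e.
- by move=> M hM; exists (Psi M); [apply: PsiM | apply: PhiPsi].
Qed.
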